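(* Let $K$ be a non-archimedean local field with $\operatorname{char}K\neq 2$, ring of integers $\mathcal{O}_K$, and let $I\in\mathcal{O}_K\setminus\{0\}$ and $\tau\in\mathcal{O}_K$ with $\tau\mid 2$. Then the local orbit counters satisfy \[\widehat{g_{V_\tau(I)}}=N(\tau)\cdot g_{V_{2\tau^{-1}}(4\tau^{-4}I)},\] where $N(\tau)=|\mathcal{O}_K/\tau\mathcal{O}_K|$.
   Context: Let $\Gamma$ be the algebraic group of matrices $\begin{bmatrix}u&t\\0&u^{-2}\end{bmatrix}$ ($u\in\mathbb{G}_m$, $t\in\mathbb{G}_a$), acting on binary quadratic forms $f=ax^2+bxy+cy^2$ by $f(x,y)\mapsto f(ux+ty,u^{-2}y)$; it preserves $I(f)=a(b^2-4ac)$. For $J\in K^\times$, the $\Gamma(K)$-orbits of forms over $K$ with $I(f)=J$ are classified by the class of $b^2-4ac$ in $K^\times/(K^\times)^2\cong H^1(K,\mathbb{Z}/2\mathbb{Z})$. For $\sigma\mid 2$ and $J\in K^\times$ let $V_\sigma(J)(\mathcal{O}_K)$ be the set of forms with $a,c\in\mathcal{O}_K$, $b\in\sigma\mathcal{O}_K$ and $I(f)=J$. The local orbit counter $g_{V_\sigma(J)}:K^\times/(K^\times)^2\to\mathbb{Z}$ sends $[D]$ to the number of cosets $\Gamma(\mathcal{O}_K)\gamma\in\Gamma(\mathcal{O}_K)\backslash\Gamma(K)$ with $\gamma f_0\in V_\sigma(J)(\mathcal{O}_K)$, where $f_0$ is any form over $K$ with $I(f_0)=J$ and $b^2-4ac\in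 D(K^\times)^2$. The Fourier transform of $g:K^\times/(K^\times)^2\to\mathbb{C}$ is $\hat g(\beta)=\frac12\sum_{\alpha}g(\alpha)\langle\alpha,\beta\rangle$, where $\langle\,,\rangle$ is the quadratic Hilbert symbol on $K^\times/(K^\times)^2$ (values $\pm1$). *)

(* Defs.v *)
From HB Require Import structures.
From mathcomp Require Import all_boot all_order all_algebra finmap.
From mathcomp Require Import generic_quotient.
From mathcomp Require Import boolp classical_sets functions cardinality fsbigop.
From mathcomp Require Import reals.
From mathcomp Require Import complex ring.

Set Implicit Arguments.
Unset Strict Implicit.
Unset Printing Implicit Defensive.
Import Order.TTheory GRing.Theory Num.Theory.
Local Open Scope classical_set_scope.
Local Open Scope quotient_scope.
Local Open Scope ring_scope.

(* [dval] is only meaningful on nonzero arguments: the value of [dval 0] is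
   unconstrained and is never used (0 has valuation +oo). *)
Record discrete_valuation (K : fieldType) := DiscreteValuation {
  dval :> K -> int;
  dvalM : forall x y, x != 0 -> y != 0 -> dval (x * y) = dval x + dval y;
  dvalD : forall x y, x != 0 -> y != 0 -> x + y != 0 ->
    Num.min (dval x) (dval y) <= dval (x + y);
  dval_onto : exists2 pi, pi != 0 & dval pi = 1 }.

Section LocalField.
Variables (K : fieldType) (v : discrete_valuation K).

Definition val_ge (n : int) : set K := [set x | x = 0 \/ n <= v x].

Definition integers : set K := val_ge 0.

Definition maximal_ideal : set K := val_ge 1.

Definition integer_units : set K :=
  [set x | [/\ x != 0, integers x & integers x^-1]].

Definition dvd_int (a b : K) : Prop := exists2 z, integers z & b = a * z.

Definition principal_ideal (a : K) : set K := [set a * z | z in integers].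

(* O_K / m for an ideal m, as the set of cosets x + m with x in O_K *)
Definition int_quot (m : set K) : set (set K) :=
  [set [set x + y | y in m] | x in integers].

Definition cauchy_seq (s : nat -> K) : Prop :=
  forall n : int, exists N : nat, forall i j : nat,
    (N <= i)%N -> (N <= j)%N -> val_ge n (s i - s j).

Definition converges_to (s : nat -> K) (l : K) : Prop :=
  forall n : int, exists N : nat, forall i : nat,
    (N <= i)%N -> val_ge n (s i - l).

Definition nonarch_local_field : Prop :=
  (forall s, cauchy_seq s -> exists l, converges_to s l) /\
  finite_set (int_quot maximal_ideal).

(* |O_K / a O_K|; [fset_set] of an infinite set is empty, but the quotient is
   finite for a != 0 when K is a local field. *)
Definition ideal_norm (a : K) : nat := #|` fset_set (int_quot (principal_ideal a))|.

End LocalField.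

Section SquareClasses.
Variable K : fieldType.

Definition nonzero := {x : K | x != 0}.

Definition square_equiv (x y : nonzero) : bool :=
  `[< exists2 z : K, z != 0 & val y = val x * z ^+ 2 >].

Lemma square_equiv_refl : reflexive square_equiv.
Proof.
by move=> x; apply/asboolP; exists 1; rewrite ?oner_neq0// expr1n mulr1.
Qed.

Lemma square_equiv_sym : symmetric square_equiv.
Proof.
have imp x y : square_equiv x y -> square_equiv y x.
  move=> /asboolP[z z0 e]; apply/asboolP; exists z^-1; first by rewrite invr_eq0.
  by rewrite e -mulrA -exprMn mulfV// expr1n mulr1.
by move=> x y; apply/idP/idP; exact: imp.
Qed.

Lemma square_equiv_trans : transitive square_equiv.
Proof.
move=> y x z /asboolP[r r0 e] /asboolP[s s0 e']; apply/asboolP.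
exists (r * s); first exact: mulf_neq0.
by rewrite e' e; ring.
Qed.

Canonical square_equiv_equiv :=
  EquivRel square_equiv square_equiv_refl square_equiv_sym square_equiv_trans.

(* K^* / (K^* )^2 *)
Definition sqclass := {eq_quot square_equiv_equiv}%qT.
HB.instance Definition _ := Choice.on sqclass.
HB.instance Definition _ := EqQuotient.on sqclass.

Definition class_repr (al : sqclass) : K := val (repr al).

Lemma class_repr_neq0 al : class_repr al != 0.
Proof. exact: (valP (repr al)). Qed.

(* [d] lies in the class [al], i.e. d \in D (K^* )^2 for al = [D] *)
Definition in_class (al : sqclass) (d : K) : Prop :=
  exists2 z : K, z != 0 & d = class_repr al * z ^+ 2.

Lemma in_class_pi (x : nonzero) : in_class (\pi x) (val x).
Proof.
have /eqmodP/asboolP[z z0 e] : \pi_sqclass (repr (\pi_sqclass x)) = \pi x.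
  exact: reprK.
by exists z.
Qed.

(* (a, b)_K = 1 iff z^2 = a x^2 + b y^2 has a nontrivial solution *)
Definition hilbert (a b : K) : int :=
  if `[< exists x y z : K, (x, y, z) != (0, 0, 0) /\
           z ^+ 2 = a * x ^+ 2 + b * y ^+ 2 >] then 1 else -1.

Definition hilbert_class (al be : sqclass) : int :=
  hilbert (class_repr al) (class_repr be).

Lemma hilbertM_sqr a b r s : r != 0 -> s != 0 ->
  hilbert (a * r ^+ 2) (b * s ^+ 2) = hilbert a b.
Proof.
move=> r0 s0; rewrite /hilbert; congr (if _ then _ else _); apply: asbool_equiv_eq.
split=> -[x [y [z [nz e]]]].
- exists (r * x), (s * y), z; split; last by rewrite e; ring.
  apply: contra nz; rewrite !xpair_eqE !mulf_eq0.
  by rewrite (negbTE r0) (negbTE s0).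
- exists (x / r), (y / s), z; split; last by rewrite e; field; rewrite r0 s0.
  apply: contra nz; rewrite !xpair_eqE !mulf_eq0 !invr_eq0.
  by rewrite (negbTE r0) (negbTE s0) !orbF.
Qed.

Lemma hilbert_classE al be a b : in_class al a -> in_class be b ->
  hilbert_class al be = hilbert a b.
Proof. by move=> [r r0 ->] [s s0 ->]; rewrite hilbertM_sqr. Qed.

(* K^* / (K^* )^2 is finite for a local field of characteristic not 2, so the
   finitely supported sum below is the full sum over the group. *)
Definition fourier (C : fieldType) (g : sqclass -> C) (be : sqclass) : C :=
  2^-1 * \sum_(al \in [set: sqclass]) g al * (hilbert_class al be)%:~R.

End SquareClasses.

Record bqf (K : Type) := BQF { qa : K; qb : K; qc : K }.
HB.instance Definition _ (K : Type) := gen_eqMixin (bqf K).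
HB.instance Definition _ (K : Type) := gen_choiceMixin (bqf K).

Section Forms.
Variable K : fieldType.
Implicit Types (f : bqf K) (g h d : 'M[K]_2).

Definition bqf_eval f (x y : K) : K :=
  qa f * x ^+ 2 + qb f * x * y + qc f * y ^+ 2.

Definition bqf_disc f : K := qb f ^+ 2 - 4 * qa f * qc f.

Definition bqf_I f : K := qa f * bqf_disc f.

Definition gamma_mx (u t : K) : 'M[K]_2 :=
  \matrix_(i < 2, j < 2) nth 0 (nth [::] [:: [:: u; t]; [:: 0; u ^- 2]] i) j.

Definition GammaK : set 'M[K]_2 :=
  [set g | exists u t, u != 0 /\ g = gamma_mx u t].

(* The form f (p x + q y, r x + s y), where g = [p q; r s]; see
   [bqf_act_eval] and [bqf_act_gamma]. *)
Definition bqf_act g f : bqf K :=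
  let p := g 0 0 in let q := g 0 1 in let r := g 1 0 in let s := g 1 1 in
  BQF (qa f * p ^+ 2 + qb f * p * r + qc f * r ^+ 2)
      (2 * qa f * p * q + qb f * (p * s + q * r) + 2 * qc f * r * s)
      (qa f * q ^+ 2 + qb f * q * s + qc f * s ^+ 2).

Lemma bqf_act_eval g f x y : bqf_eval (bqf_act g f) x y =
  bqf_eval f (g 0 0 * x + g 0 1 * y) (g 1 0 * x + g 1 1 * y).
Proof. by rewrite /bqf_eval /=; ring. Qed.

(* f |-> f \o g turns matrix products around, so it is a left action for the
   law below ("act by h, then by g"), which is the law on Gamma for which the
   cosets Gamma(O_K) g and the condition "g f0 is integral" are compatible. *)
Definition gamma_mul g h : 'M[K]_2 := h *m g.

Lemma gamma_mulE g h i j : gamma_mul g h i j = h i 0 * g 0 j + h i 1 * g 1 j.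
Proof.
rewrite mxE big_ord_recl big_ord1; congr (_ + h i _ * g _ j); exact: val_inj.
Qed.

Lemma bqf_act_mul g h f : bqf_act (gamma_mul g h) f = bqf_act g (bqf_act h f).
Proof. by rewrite /bqf_act !gamma_mulE /=; congr BQF; ring. Qed.

Lemma gamma_mxE (u t : K) : let g := gamma_mx u t in
  (g 0 0 = u) * (g 0 1 = t) * (g 1 0 = 0) * (g 1 1 = u ^- 2).
Proof. by rewrite /= !mxE. Qed.

Lemma bqf_act_gamma u t f x y : bqf_eval (bqf_act (gamma_mx u t) f) x y =
  bqf_eval f (u * x + t * y) (u ^- 2 * y).
Proof. by rewrite bqf_act_eval !gamma_mxE mul0r add0r. Qed.

Lemma bqf_I_act g f : GammaK g -> bqf_I (bqf_act g f) = bqf_I f.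
Proof.
move=> [u [t [u0 ->]]]; rewrite /bqf_I /bqf_disc /= !gamma_mxE.
by field.
Qed.

End Forms.

Section OrbitCounter.
Variables (K : fieldType) (v : discrete_valuation K).

Definition GammaO : set 'M[K]_2 :=
  [set g | exists u t, [/\ integer_units v u, integers v t & g = gamma_mx u t]].

(* V_s(J)(O_K) *)
Definition Vint (s J : K) : set (bqf K) :=
  [set f | [/\ integers v (qa f), principal_ideal v s (qb f),
               integers v (qc f) & bqf_I f = J]].

(* the coset Gamma(O_K) g *)
Definition gamma_coset (g : 'M[K]_2) : set 'M[K]_2 :=
  [set gamma_mul d g | d in GammaO].

Definition integral_cosets (s J : K) (f0 : bqf K) : set (set 'M[K]_2) :=
  [set gamma_coset g | g in [set g | GammaK g /\ Vint s J (bqf_act g f0)]].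

(* The cardinality is finite for J != 0 over a local field. *)
Definition coset_count (s J : K) (f0 : bqf K) : nat :=
  #|` fset_set (integral_cosets s J f0)|.

Definition base_form (J : K) (al : sqclass K) : bqf K :=
  xget (BQF 0 0 0) [set f | bqf_I f = J /\ in_class al (bqf_disc f)].

(* By [orbit_counterE] below, the choice of [base_form] is irrelevant. *)
Definition orbit_counter (s J : K) (al : sqclass K) : nat :=
  coset_count s J (base_form J al).

End OrbitCounter.

Section OrbitCounterWellDefined.
Variables (K : fieldType) (v : discrete_valuation K).
Hypothesis two_neq0 : (2 : K) != 0.

Let four_neq0 : (4 : K) != 0.
Proof. by rewrite (_ : 4 = 2 * 2 :> K) ?mulf_neq0// -natrM. Qed.

Lemma base_form_exists (J : K) (al : sqclass K) : J != 0 ->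
  exists f, bqf_I f = J /\ in_class al (bqf_disc f).
Proof.
move=> J0; have D0 := class_repr_neq0 al; set D := class_repr al in D0 *.
exists (BQF (J / D) 0 (- (D ^+ 2 / (4 * J)))); rewrite /bqf_I /bqf_disc /=.
split; first by field; rewrite D0 J0 four_neq0.
by exists 1; rewrite ?oner_neq0// -/D; field; rewrite D0 J0 four_neq0.
Qed.

Lemma gamma_transitive (f f' : bqf K) (z : K) : z != 0 -> bqf_I f != 0 ->
  bqf_I f' = bqf_I f -> bqf_disc f' = bqf_disc f * z ^+ 2 ->
  exists2 g, GammaK g & f' = bqf_act g f.
Proof.
move=> z0 If0 eI eD.
have [a0 D0] : qa f != 0 /\ bqf_disc f != 0.
  by apply/andP; move: If0; rewrite mulf_eq0 negb_or.
have ea : qa f' = qa f * z ^- 2.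
  apply: (mulIf (_ : bqf_disc f * z ^+ 2 != 0)); first by rewrite mulf_neq0// expf_neq0.
  by rewrite -{1}eD [LHS]eI /bqf_I; field.
pose t := (qb f' - qb f * z) * z / (2 * qa f).
exists (gamma_mx z^-1 t); first by exists z^-1, t; rewrite invr_eq0.
have eb : qb f' = 2 * qa f * z^-1 * t + qb f * z.
  by rewrite /t; field; rewrite z0 a0 two_neq0.
have ec : qc f' = (qb f' ^+ 2 - bqf_disc f') / (4 * qa f').
  rewrite /bqf_disc; field; rewrite four_neq0 ea mulf_neq0//.
  by rewrite invr_eq0 expf_neq0.
have -> : f' = BQF (qa f') (qb f') (qc f') by case: f' {eI eD ea t eb ec}.
rewrite /bqf_act !gamma_mxE ec eD ea eb /bqf_disc; congr BQF; field.
all: by rewrite ?z0 ?a0 ?four_neq0 ?oner_neq0.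
Qed.

Lemma GammaK_mul (g h : 'M[K]_2) : GammaK g -> GammaK h -> GammaK (gamma_mul g h).
Proof.
move=> [u [t [u0 ->]]] [w [r [w0 ->]]]; exists (w * u), (w * t + r * u ^- 2).
split; first exact: mulf_neq0.
apply/matrixP => i j; rewrite /gamma_mul !mxE !big_ord_recl big_ord0 !mxE /=.
case: i => [[|[|//]] ?]; case: j => [[|[|//]] ?] /=; field; by rewrite ?w0 ?u0.
Qed.

Lemma GammaK_inv (h : 'M[K]_2) : GammaK h ->
  exists2 k, GammaK k & h *m k = 1%:M /\ k *m h = 1%:M.
Proof.
move=> [u [t [u0 ->]]]; exists (gamma_mx u^-1 (- t * u)).
  by exists u^-1, (- t * u); rewrite invr_eq0.
split; apply/matrixP => i j; rewrite !mxE !big_ord_recl big_ord0 !mxE /=.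
all: case: i => [[|[|//]] ?]; case: j => [[|[|//]] ?] /=;
  field; rewrite ?invr_eq0 ?oner_neq0 ?u0.
all: by [].
Qed.

Lemma coset_count_act (s J : K) (f : bqf K) (h : 'M[K]_2) : GammaK h ->
  coset_count v s J (bqf_act h f) = coset_count v s J f.
Proof.
move=> Gh; have [k Gk [hk kh]] := GammaK_inv Gh.
pose phi (C : set 'M[K]_2) : set 'M[K]_2 := [set gamma_mul m h | m in C].
have phi_inj : injective phi.
  apply: (can_inj (g := fun C => [set gamma_mul m k | m in C])) => C.
  apply/seteqP; split=> [_ [_ [m Cm <-] <-]|m Cm].
    by rewrite /gamma_mul mulmxA kh mul1mx.
  exists (gamma_mul m h); first by exists m.
  by rewrite /gamma_mul mulmxA kh mul1mx.
have phi_coset g : phi (gamma_coset v g) = gamma_coset v (gamma_mul g h).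
  apply/seteqP; split=> [_ [_ [d Gd <-] <-]|_ [d Gd <-]].
    by exists d => //; rewrite /gamma_mul mulmxA.
  by exists (gamma_mul d g); [exists d|rewrite /gamma_mul mulmxA].
have -> : coset_count v s J f =
    #|` fset_set (phi @` integral_cosets v s J (bqf_act h f))|.
  congr (#|` fset_set _|); apply/seteqP; split=> [_ [g [Gg Vg] <-]|].
    have eg : g = gamma_mul (gamma_mul g k) h.
      by rewrite /gamma_mul mulmxA hk mul1mx.
    exists (gamma_coset v (gamma_mul g k)); last by rewrite phi_coset -eg.
    exists (gamma_mul g k) => //; split; first exact: GammaK_mul.
    by rewrite -bqf_act_mul -eg.
  move=> _ [_ [g [Gg Vg] <-] <-]; rewrite phi_coset; exists (gamma_mul g h) => //.
  by split; [exact: GammaK_mul|rewrite bqf_act_mul].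
rewrite /coset_count; set A := integral_cosets _ _ _ _.
have [finA|infA] := pselect (finite_set A).
  by rewrite (fset_set_image phi finA) card_imfset.
have infB : ~ finite_set (phi @` A).
  move=> /(finite_preimage (in2W phi_inj)) finA; apply: infA.
  exact: sub_finite_set (@preimage_image _ _ phi A) finA.
by rewrite /fset_set; case: pselect => //; case: pselect.
Qed.

Lemma orbit_counterE (s J : K) (al : sqclass K) (f0 : bqf K) : J != 0 ->
  bqf_I f0 = J -> in_class al (bqf_disc f0) ->
  orbit_counter v s J al = coset_count v s J f0.
Proof.
move=> J0 I0 [r r0 eD0].
have [] := xgetPex (BQF 0 0 0) (base_form_exists al J0).
rewrite -/(base_form J al) /orbit_counter; set f := base_form J al => If [z z0 eD].
have [| | | |g Gg ->] := @gamma_transitive f0 f (z / r).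
- by rewrite mulf_neq0// invr_eq0.
- by rewrite I0.
- by rewrite If I0.
- by rewrite eD eD0; field.
- exact: coset_count_act.
Qed.

End OrbitCounterWellDefined.

(* Main.v *)
Require Import Defs.
From mathcomp Require Import all_boot all_order all_algebra finmap.
From mathcomp Require Import generic_quotient.
From mathcomp Require Import boolp classical_sets functions cardinality fsbigop.
From mathcomp Require Import reals complex.
From mathcomp Require Import zify ring.

Set Implicit Arguments.
Unset Strict Implicit.
Unset Printing Implicit Defensive.
Import Order.TTheory GRing.Theory Num.Theory.
Local Open Scope classical_set_scope.
Local Open Scope card_scope.
Local Open Scope ring_scope.

(** Write e = v(2), q for the residue cardinality and, for i an integer, H_i for
    the group of classes in K^*/(K^* )^2 that are squares modulo pi^(2i) up to
    squares: everything for i < 0, even valuation for i = 0, trivial for i > e.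
    The Hilbert symbol makes H_i and H_(e - i) exact annihilators of each other.
    Indeed 1 + a is a norm from K(sqrt(1 + b)) as soon as 1 - ab is a square,
    while if 1 - ab is an unramified nonsquare and v(a) is odd it is not; and
    norms have index at most 2 because, after reduction by norms, the obstruction
    for 1 + a is the class of 1 - ab in H_e, a group of order 2.

    A form of discriminant class D in V_s(J) with v(a) fixed amounts to a square
    root of an element of class D modulo a power of pi.  Hence g_(V_s(J)) is a
    sum over 0 <= v(a) <= v(J) - 2 v(s) of explicit multiples of indicators of
    square classes.  Grouping v(a) = 2m with v(a) = 2m + 1 turns each pair into a
    multiple of the indicator of a single H_i, and the Fourier transform exchanges
    the pairs for tau and for 2/tau.  The only exception (e = 0, v(J) odd, middle
    pair) is a self-dual combination of three indicators. *)

(** * Discrete valuations *)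

(* [zify] case-splits on every boolean hypothesis, so the facts x != 0 about
   field elements must be dropped before calling [lia]. *)
Ltac vlia :=
  repeat match goal with H : is_true (negb (eq_op _ _)) |- _ => clear H end; lia.

(** Why orbits become square roots: moving a form without middle term, of discriminant D, by
    [gamma_mx u (u * t)] yields a = (J/D)u^2, b = 2at and c = a(t^2 - δ) with δ in the class of D.
    Integrality of c is a congruence for t^2 modulo pi^(-v(a)); that of b only bounds v(a).

    Why the factor is N(tau): up to 1/2, the transform sends the indicator of H_i to |H_i| times
    that of H_(e - i), where |H_i| is 4q^e, 2q^(e - i) or 1. The pair numbered mu from one end and h
    from the other carries the level i = v(2/tau) + mu - h, so exchanging tau with 2/tau and mu with
    h replaces i by e - i, and the orders |H_i| make up the difference in weights except for
    2q^v(tau).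

    The main obstacle is that the Hilbert symbol is defined by isotropy, so its bilinearity is the
    statement that norms have index at most 2. Odd and even residue characteristic both have to be
    covered; the facts needed about the residue field come from counting fibres of x^2 or x^2 + x on
    a finite set of representatives. *)

Section Valuation.
Variables (K : fieldType) (v : discrete_valuation K).
Local Notation ge := (val_ge v).
Implicit Types (l m n : int) (x y z : K).

Lemma dval1 : v 1 = 0.
Proof.
have := @dvalM K v 1 1 (oner_neq0 _) (oner_neq0 _).
by rewrite mulr1; lia.
Qed.

Lemma dvalV x : x != 0 -> v x^-1 = - v x.
Proof.
move=> x0; have := @dvalM K v x x^-1 x0; rewrite invr_eq0 mulfV// dval1.
by move=> /(_ x0); lia.
Qed.

Lemma dvalX2 x : x != 0 -> v (x ^+ 2) = 2 * v x.
Proof. by move=> x0; rewrite expr2 dvalM//; lia. Qed.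

Lemma dvalN x : x != 0 -> v (- x) = v x.
Proof.
move=> x0; have N0 : (-1 : K) != 0 by rewrite oppr_eq0 oner_neq0.
have := dvalX2 N0; rewrite sqrrN expr1n dval1 => h.
by rewrite -mulN1r dvalM//; lia.
Qed.

Lemma val_surj (n : int) : exists2 x : K, x != 0 & v x = n.
Proof.
have [p p0 p1] := dval_onto v.
have vn k : v (p ^+ k) = k%:Z.
  elim: k => [|k IH]; first by rewrite expr0 dval1.
  by rewrite exprS dvalM// ?expf_neq0// IH p1; lia.
case: n => k; first by exists (p ^+ k); rewrite ?expf_neq0.
by exists (p ^- k.+1); rewrite ?invr_eq0 ?expf_neq0// dvalV ?expf_neq0// vn; lia.
Qed.

Lemma val_ge0 n : ge n 0. Proof. by left. Qed.
Hint Resolve val_ge0 : core.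

Lemma val_geE n x : x != 0 -> ge n x = (n <= v x) :> Prop.
Proof. by move=> x0; apply/propext; split=> [[/eqP|//]|]; [rewrite (negbTE x0)|right]. Qed.

Lemma val_ge_le (m n : int) x : m <= n -> ge n x -> ge m x.
Proof. by move=> mn [->//|h]; right; lia. Qed.

Lemma val_ge_self x : ge (v x) x. Proof. by right. Qed.

Lemma val_ge_self_le n x : n <= v x -> ge n x. Proof. by right. Qed.

Lemma val_geN n x : ge n x -> ge n (- x).
Proof.
have [->|x0] := eqVneq x 0; first by rewrite oppr0.
by rewrite !val_geE ?oppr_eq0// dvalN.
Qed.

Lemma val_geD n x y : ge n x -> ge n y -> ge n (x + y).
Proof.
have [->|x0] := eqVneq x 0; first by rewrite add0r.
have [->|y0] := eqVneq y 0; first by rewrite addr0.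
have [->//|xy0] := eqVneq (x + y) 0.
rewrite !val_geE// => hx hy; have := dvalD v x0 y0 xy0.
by rewrite ge_min => /orP[]; apply: le_trans.
Qed.

Lemma val_geB n x y : ge n x -> ge n y -> ge n (x - y).
Proof. by move=> hx hy; apply: val_geD => //; exact: val_geN. Qed.

Lemma val_geM m n x y : ge m x -> ge n y -> ge (m + n) (x * y).
Proof.
have [->|x0] := eqVneq x 0; first by rewrite mul0r.
have [->|y0] := eqVneq y 0; first by rewrite mulr0.
by rewrite !val_geE ?mulf_neq0// dvalM//; lia.
Qed.

Lemma val_geM_le l m n x y : l <= m + n -> ge m x -> ge n y -> ge l (x * y).
Proof. by move=> h hx hy; apply: val_ge_le h _; exact: val_geM. Qed.

Lemma val_geMl n x y : x != 0 -> ge (v x + n) (x * y) <-> ge n y.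
Proof.
move=> x0; have [->|y0] := eqVneq y 0; first by rewrite mulr0.
by rewrite !val_geE ?mulf_neq0// dvalM//; lia.
Qed.

Lemma val_geV m n x y : x != 0 -> v x = m -> ge n y -> ge (n - m) (y / x).
Proof.
move=> x0 vx hy; have := val_geM hy (val_ge_self x^-1).
by rewrite dvalV// vx.
Qed.

Lemma val_geX2 n x : ge n x -> ge (2 * n) (x ^+ 2).
Proof. by move=> hx; rewrite expr2; apply: (val_geM_le _ hx hx); lia. Qed.

(** [- (- n %/ 2)] is n/2 rounded up, as [%/] rounds down. *)
Lemma val_geX2E n x : ge n (x ^+ 2) -> ge (- (- n %/ 2)%Z) x.
Proof.
have [->//|x0] := eqVneq x 0.
by rewrite !val_geE ?expf_neq0// dvalX2//; lia.
Qed.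

Lemma val_ge_nat (n : nat) : ge 0 (n%:R).
Proof.
elim: n => [//|n IH]; rewrite mulrS; apply: val_geD => //.
by right; rewrite dval1.
Qed.

Lemma val_ge1 : ge 0 1. Proof. exact: (val_ge_nat 1). Qed.

Lemma val_ge_subC n x y : ge n (x - y) -> ge n (y - x).
Proof. by move=> h; rewrite -opprB; exact: val_geN. Qed.

Lemma val_ge_trans n x y z : ge n (x - y) -> ge n (y - z) -> ge n (x - z).
Proof.
by move=> h h'; have := val_geD h h'; rewrite addrA subrK.
Qed.

Lemma not_val_ge n x : ~ ge n x -> x != 0 /\ v x < n.
Proof.
move=> h; have x0 : x != 0 by apply/eqP => x0; apply: h; rewrite x0.
by split=> //; move: h; rewrite val_geE//; lia.
Qed.

Lemma val_add_dominant x y : x != 0 -> ge (v x + 1) y ->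
  x + y != 0 /\ v (x + y) = v x.
Proof.
move=> x0 hy; have xy0 : x + y != 0.
  apply/eqP => h; have {}h : x = - y by apply/eqP; rewrite -addr_eq0 h.
  have := val_geN hy; rewrite -h val_geE//; lia.
split=> //.
have h1 : ge (v x) (x + y) by apply: val_geD; [right|apply: val_ge_le hy; lia].
have : ~ ge (v x + 1) (x + y).
  move=> h; have := val_geB h hy; rewrite addrK val_geE//; lia.
by move: h1; rewrite !val_geE//; lia.
Qed.

Lemma val_one_add z : ge 1 z -> 1 + z != 0 /\ v (1 + z) = 0.
Proof.
by move=> hz; have := @val_add_dominant 1 z (oner_neq0 _); rewrite dval1; apply.
Qed.

Lemma val_congr x y : x != 0 -> ge (v x + 1) (y - x) -> y != 0 /\ v y = v x.
Proof.
by move=> x0 h; have := val_add_dominant x0 h; rewrite addrC subrK.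
Qed.

Lemma val_ge_limit n (s : nat -> K) (l : K) (N : nat) : converges_to v s l ->
  (forall i, (N <= i)%N -> ge n (s i)) -> ge n l.
Proof.
move=> /(_ n)[M hM] hs; pose i := maxn M N.
have h1 := hM i (leq_maxl _ _); have h2 := hs i (leq_maxr _ _).
by have := val_geB h2 h1; rewrite subKr.
Qed.

Lemma val_ge_eq0 x : (forall n, ge n x) -> x = 0.
Proof.
move=> h; apply/eqP/negP => /negP x0; have := h (v x + 1).
by rewrite val_geE//; lia.
Qed.

End Valuation.

(** * Counting *)

Section Counting.

(** Only the fibres on [P] matter. This lets two descriptions of a set of cosets be compared without
    exhibiting a bijection. *)
Lemma card_image_congr (T : choiceType) (U V : Type) (f : T -> U) (g : T -> V)
    (P : set T) :
  (forall x y, P x -> P y -> f x = f y <-> g x = g y) -> f @` P #= g @` P.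
Proof.
have le (U' V' : Type) (f' : T -> U') (g' : T -> V') :
    (forall x y, P x -> P y -> g' x = g' y -> f' x = f' y) -> f' @` P #<= g' @` P.
  move=> h; have [->|/set0P[x0 Px0]] := eqVneq P set0; first by rewrite !image_set0.
  pose k u := f' (xget x0 [set x | P x /\ g' x = u]).
  have -> : f' @` P = k @` (g' @` P).
    rewrite image_comp; apply: eq_imagel => x Px /=; rewrite /k.
    by case: xgetP => [y _ [Py e]|/(_ x)[]//]; exact: h.
  exact: card_image_le.
move=> h; rewrite card_eq_le; apply/andP.
by split; apply: le => x y Px Py /(h x y Px Py).
Qed.

Lemma finite_card_eq (T : choiceType) (A : set T) :
  finite_set A -> A #= `I_#|` fset_set A|%fset.
Proof.
by move=> fA; rewrite -{1}(fset_setK fA); apply/card_eq_fsetP.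
Qed.

Lemma card_eq_setX (T U : choiceType) (A : set T) (B : set U) m n :
  A #= `I_m -> B #= `I_n -> A `*` B #= `I_(m * n).
Proof.
move=> hA hB.
have fA : finite_set A by apply/finite_setP; exists m.
have fB : finite_set B by apply/finite_setP; exists n.
have := finite_card_eq (finite_setX fA fB).
rewrite fset_setX//; set X := fset_set A; set Y := fset_set B.
suff /perm_size -> : perm_eq (X `*` Y)%fset (allpairs pair X Y).
  by rewrite size_allpairs (card_fset_set hA) (card_fset_set hB).
apply: uniq_perm => [||[x y]]; first exact: fset_uniq.
  by rewrite allpairs_uniq ?fset_uniq// => -[? ?] [? ?].
rewrite in_fsetM /=; apply/idP/allpairsP => [/andP[xX yY]|[[a b] [? ? [-> ->]]]].
  by exists (x, y).
exact/andP.
Qed.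

Lemma card_eq_setU (T : choiceType) (A B : set T) m n :
  A #= `I_m -> B #= `I_n -> A `&` B = set0 -> A `|` B #= `I_(m + n).
Proof.
move=> hA hB d.
have fA : finite_set A by apply/finite_setP; exists m.
have fB : finite_set B by apply/finite_setP; exists n.
have fAB : finite_set (A `|` B) by rewrite finite_setU.
have := finite_card_eq fAB.
rewrite fset_setU// cardfsU -fset_setI// d fset_set0 cardfs0 subn0.
by rewrite (card_fset_set hA) (card_fset_set hB).
Qed.

Lemma card_eq_bigcup (T : choiceType) (F : nat -> set T) (c : nat -> nat) n :
  (forall i, (i < n)%N -> F i #= `I_(c i)) ->
  (forall i j, (i < n)%N -> (j < n)%N -> F i `&` F j !=set0 -> i = j) ->
  \bigcup_(i < n) F i #= `I_(\sum_(i < n) c i).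
Proof.
elim: n => [|n IH] hF tF.
  by rewrite II0 bigcup_set0 big_ord0 II0 card_eq00.
rewrite bigcup_mkord !big_ord_recr /= -bigcup_mkord.
apply: card_eq_setU; [|exact: hF|].
  by apply: IH => [i /ltnW/hF//|i j hi hj]; apply: tF; exact: ltnW.
apply/seteqP; split=> [x [[i /= hi Fx] Fnx]|//].
have e : i = n by apply: tF (ltnW hi) (ltnSn n) _; exists x.
by rewrite e ltnn in hi.
Qed.

(** A fibre has at most two points, picked by [s1] and [s2], so two copies of the image cover
    [X]. *)
Lemma card_le_double_image (T U : choiceType) (X : {fset T}) (f : T -> U) :
  (forall x y z, x \in X -> y \in X -> z \in X -> f x = f y -> f x = f z ->
     [\/ x = y, y = z | x = z]) ->
  (#|` X| <= 2 * #|` [fset f x | x in X]%fset|)%N.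
Proof.
move=> h; have [->|[x0 X0]] := fset_0Vmem X; first by rewrite cardfs0.
set Y := [fset f x | x in X]%fset.
pose s1 y := xget x0 [set x | x \in X /\ f x = y].
pose s2 y := xget x0 [set x | [/\ x \in X, f x = y & x <> s1 y]].
suff sub : (X `<=` [fset s1 y | y in Y] `|` [fset s2 y | y in Y])%fset.
  apply: leq_trans (fsubset_leq_card sub) _; rewrite cardfsU.
  apply: leq_trans (leq_subr _ _) _; rewrite mul2n -addnn.
  by apply: leq_add; exact: leq_imfset_card.
apply/fsubsetP => x xX; rewrite in_fsetU.
have fY : f x \in Y by apply/imfsetP; exists x.
have [s1X s1f] : s1 (f x) \in X /\ f (s1 (f x)) = f x.
  by rewrite /s1; case: xgetP => [y _ []//|/(_ x)[]].
have [e|ne] := eqVneq x (s1 (f x)).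
  by apply/orP; left; apply/imfsetP; exists (f x).
have [s2X s2f s2n] : [/\ s2 (f x) \in X, f (s2 (f x)) = f x & s2 (f x) <> s1 (f x)].
  by rewrite /s2; case: xgetP => [y _ []//|/(_ x)[]]; split=> //; exact/eqP.
apply/orP; right; apply/imfsetP; exists (f x) => //.
have := h x (s1 (f x)) (s2 (f x)) xX s1X s2X; rewrite s1f s2f.
case=> // e; first by rewrite -e eqxx in ne.
by rewrite e in s2n.
Qed.

Lemma nonsurj_of_noninj (T : choiceType) (X : {fset T}) (f : T -> T) a b :
  {in X, forall x, f x \in X} -> a \in X -> b \in X -> a != b -> f a = f b ->
  exists2 y, y \in X & {in X, forall x, f x <> y}.
Proof.
move=> fX aX bX ab fab; apply: contrapT => h.
suff sub : (X `<=` [fset f x | x in (X `\ b)])%fset.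
  have := leq_trans (fsubset_leq_card sub) (leq_imfset_card _ _ _).
  by rewrite (cardfsD1 b X) bX /= ltnn.
apply/fsubsetP => y yX; apply: contrapT => yn; apply: h; exists y => // x xX e.
apply: yn; apply/imfsetP; have [xb|xb] := eqVneq x b; last first.
  by exists x; rewrite ?in_fsetD1 /= ?xb.
by exists a; rewrite ?in_fsetD1 /= ?ab// fab -xb.
Qed.

Lemma surj_of_inj (T : choiceType) (X : {fset T}) (f : T -> T) :
  {in X, forall x, f x \in X} -> {in X &, injective f} ->
  {in X, forall y, exists2 x, x \in X & y = f x}.
Proof.
move=> fX finj y yX.
have sub : ([fset f x | x in X] `<=` X)%fset.
  by apply/fsubsetP => _ /imfsetP[x xX ->]; exact: fX.
have /eqP e : [fset f x | x in X]%fset == X.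
  by rewrite eqEfcard sub card_in_imfset /= ?leqnn.
by rewrite -{1}e in yX; case/imfsetP: yX => x xX ->; exists x.
Qed.

(** Each image has at least half the size of [X], so three of them cannot be pairwise disjoint. This
    plays the part of the fact that a subgroup of index 2 has a single nontrivial coset. *)
Lemma three_two_to_one_meet (T : choiceType) (X : {fset T}) (f g h : T -> T) x0 :
  x0 \in X ->
  (forall k, k = f \/ k = g \/ k = h -> {in X, forall x, k x \in X} /\
    forall x y z, x \in X -> y \in X -> z \in X -> k x = k y -> k x = k z ->
     [\/ x = y, y = z | x = z]) ->
  exists x y, [/\ x \in X, y \in X & [\/ f x = g y, f x = h y | g x = h y]].
Proof.
move=> x0X hk; apply: contrapT => no.
have [fX /card_le_double_image cf] := hk f (or_introl erefl).
have [gX /card_le_double_image cg] := hk g (or_intror (or_introl erefl)).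
have [hX /card_le_double_image ch] := hk h (or_intror (or_intror erefl)).
set F := [fset f x | x in X]%fset in cf.
set G := [fset g x | x in X]%fset in cg.
set H := [fset h x | x in X]%fset in ch.
have FG : [disjoint F & G]%fset.
  apply/fdisjointP => _ /imfsetP[x xX ->]; apply/negP => /imfsetP[y yX e].
  by apply: no; exists x, y; split=> //; apply: Or31.
have FGH : [disjoint (F `|` G)%fset & H]%fset.
  apply/fdisjointP => z; rewrite in_fsetU => zFG; apply/negP => /imfsetP[y yX e].
  case/orP: zFG => /imfsetP[x xX e']; apply: no; exists x, y; split=> //.
  - by apply: Or32; rewrite -e'.
  - by apply: Or33; rewrite -e'.
have sub : ((F `|` G) `|` H `<=` X)%fset.
  by rewrite !fsubUset; apply/andP; split; [apply/andP; split|];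
    apply/fsubsetP => _ /imfsetP[x xX ->]; [apply: fX|apply: gX|apply: hX].
have := fsubset_leq_card sub; rewrite cardfsU (disjoint_fsetI0 FGH) cardfs0.
rewrite cardfsU (disjoint_fsetI0 FG) cardfs0 !subn0.
have : (0 < #|` X|)%N by rewrite (cardfsD1 x0 X) x0X.
by lia.
Qed.

End Counting.

(** * Squares and the residue field *)

Section Hensel.
Variables (K : fieldType) (v : discrete_valuation K).
Hypothesis completeK : forall s, cauchy_seq v s -> exists l, converges_to v s l.
Hypothesis two_neq0 : (2 : K) != 0.
Local Notation ge := (val_ge v).
Local Notation e := (v 2).
Implicit Types (l m n : int) (x y z : K).

Lemma four_sqr : (4 : K) = 2 ^+ 2. Proof. by ring. Qed.

Lemma four_neq0 : (4 : K) != 0. Proof. by rewrite four_sqr expf_neq0. Qed.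

Lemma val_two_ge0 : 0 <= e.
Proof. by have := val_ge_nat v 2; rewrite val_geE. Qed.

Lemma val_four : v 4 = 2 * e. Proof. by rewrite four_sqr dvalX2. Qed.

(** The root is a fixed point of [x -> z - x ^+ 2], which contracts the maximal ideal because a^2 -
    b^2 = (a - b)(a + b); [s] is the sequence of iterates. *)
Lemma small_artin_schreier_root z : ge 1 z -> exists2 x, ge 1 x & x ^+ 2 + x = z.
Proof.
move=> hz; pose s := fix s (n : nat) : K := if n is n'.+1 then z - s n' ^+ 2 else 0.
have s1 (n : nat) : ge 1 (s n).
  elim: n => [|n IH]; first exact: val_ge0.
  by apply: val_geB => //; apply: val_ge_le (val_geX2 IH); lia.
have sS (n : nat) : ge (n%:Z + 1) (s n.+1 - s n).
  elim: n => [|n IH]; first by rewrite /= expr2 mulr0 !subr0.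
  have -> : s n.+2 - s n.+1 = - ((s n.+1 - s n) * (s n.+1 + s n)) by rewrite /=; ring.
  apply: val_geN; apply: (val_geM_le _ IH (val_geD (s1 _) (s1 _))); lia.
have sD (N k : nat) : ge (N%:Z + 1) (s (N + k)%N - s N).
  elim: k => [|k IH]; first by rewrite addn0 subrr; exact: val_ge0.
  rewrite addnS; apply: val_ge_trans IH.
  by apply: val_ge_le (sS _); lia.
have [|x hx] := completeK (s := s).
  move=> n; exists `|n|%N => i j hi hj.
  apply: (@val_ge_trans _ _ _ _ (s `|n|%N)).
    by rewrite -(subnKC hi); apply: val_ge_le (sD _ _); lia.
  by apply: val_ge_subC; rewrite -(subnKC hj); apply: val_ge_le (sD _ _); lia.
have x1 : ge 1 x by apply: (val_ge_limit (N := 0%N) hx).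
exists x => //; apply/eqP; rewrite -subr_eq0; apply/eqP/val_ge_eq0 => n.
have [N hN] := hx n.
have -> : x ^+ 2 + x - z = - (s N.+1 - x) - (s N - x) * (x + s N) by rewrite /=; ring.
apply: val_geB; first by apply: val_geN; apply: hN.
by apply: (val_geM_le _ (hN N (leqnn N)) (val_geD x1 (s1 N))); lia.
Qed.

Definition is_square (d : K) : Prop := exists2 y : K, y != 0 & d = y ^+ 2.

Lemma is_squareM x y : is_square x -> is_square y -> is_square (x * y).
Proof. by move=> [a a0 ->] [b b0 ->]; exists (a * b); rewrite ?mulf_neq0// exprMn. Qed.

Lemma is_squareV x : is_square x -> is_square x^-1.
Proof. by move=> [a a0 ->]; exists a^-1; rewrite ?invr_eq0// exprVn. Qed.

Lemma is_square_sqr x : x != 0 -> is_square (x ^+ 2).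
Proof. by move=> x0; exists x. Qed.

Lemma is_square_neq0 x : is_square x -> x != 0.
Proof. by move=> [a a0 ->]; rewrite expf_neq0. Qed.

Lemma is_square_one_add4 z : ge 1 z -> is_square (1 + 4 * z).
Proof.
move=> /small_artin_schreier_root[x x1 <-]; exists (1 + 2 * x); last by ring.
have /val_one_add[]// : ge 1 (2 * x).
by apply: (val_geM_le _ (val_ge_nat v 2) x1); lia.
Qed.

(** The local square theorem: dividing by [b ^+ 2] leaves [1 + 4 * z] with [z] in the maximal ideal,
    so the threshold is the valuation of 4 plus one. *)
Lemma is_square_near d b : d != 0 -> ge (v d + 2 * e + 1) (d - b ^+ 2) -> is_square d.
Proof.
move=> d0 h; have e0 := val_two_ge0.
have [b20 vb] : b ^+ 2 != 0 /\ v (b ^+ 2) = v d.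
  by apply: val_congr => //; apply: val_ge_subC; apply: val_ge_le h; lia.
have b0 : b != 0 by move: b20; rewrite expf_eq0.
have b40 : 4 * b ^+ 2 != 0 by rewrite mulf_neq0 ?four_neq0.
have -> : d = b ^+ 2 * (1 + 4 * ((d - b ^+ 2) / (4 * b ^+ 2))).
  by field; rewrite b0 four_neq0.
apply: is_squareM; first exact: is_square_sqr.
apply: is_square_one_add4.
have := val_geV b40 erefl h; rewrite dvalM ?four_neq0// val_four vb.
by apply: val_ge_le; lia.
Qed.

(** The factors y - 1 and y + 1 differ by 2: if [v (y - 1) < e] they have equal valuations and the
    product has even valuation; otherwise both have valuation at least [e]. Hence [1 + a] is no
    square when [v a] is odd and below [2 * e]. *)
Lemma val_sqr_sub1_odd n y : v (y ^+ 2 - 1) = 2 * n + 1 -> y ^+ 2 - 1 != 0 ->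
  2 * e <= 2 * n + 1.
Proof.
have -> : y ^+ 2 - 1 = (y - 1) * (y - 1 + 2) by ring.
move=> vy; rewrite mulf_eq0 negb_or => /andP[y1 y2]; rewrite dvalM// in vy.
have [h|h] := leP (v (y - 1)) (e - 1).
  have [|_ h2] := @val_add_dominant _ v (y - 1) 2 y1; first by rewrite val_geE//; lia.
  by move: vy; rewrite h2; lia.
have : ge e (y - 1 + 2) by apply: val_geD; rewrite val_geE//; lia.
by rewrite val_geE//; lia.
Qed.

End Hensel.

(** * Arithmetic of the finite residue field and the unramified square class *)

Section Residue.
Variables (K : fieldType) (v : discrete_valuation K).
Local Notation ge := (val_ge v).
Local Notation e := (v 2).
Implicit Types (l m n : int) (x y z : K).

(** [xget] chooses from a set that depends only on the residue class, so congruent elements get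
    equal representatives and the residue field is modelled by a finite subset of [K]. *)
Definition residue x : K := xget 0 [set y | ge 0 y /\ ge 1 (x - y)].

Definition residues : set K := residue @` integers v.

Lemma residue_congr x y : ge 1 (x - y) -> residue x = residue y.
Proof.
move=> h; rewrite /residue; congr xget; apply/seteqP; split=> z [z0 hz]; split=> //.
  by apply: val_ge_trans hz; exact: val_ge_subC.
exact: val_ge_trans hz.
Qed.

Lemma residueP x : ge 0 x -> ge 0 (residue x) /\ ge 1 (x - residue x).
Proof.
move=> hx; rewrite /residue; case: xgetP => [y _ //|/(_ x)[]].
by split=> //; rewrite subrr; exact: val_ge0.
Qed.

Lemma residue_inj x y : ge 0 x -> ge 0 y -> residue x = residue y -> ge 1 (x - y).
Proof.
move=> /residueP[_ hx] /residueP[_ hy] h; rewrite h in hx.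
by apply: val_ge_trans hx _; exact: val_ge_subC.
Qed.

Lemma residues_id x : residues x -> ge 0 x /\ residue x = x.
Proof.
move=> [y /residueP[h1 h2] <-]; split=> //.
by apply: residue_congr; exact: val_ge_subC.
Qed.

Lemma residues_inj x y : residues x -> residues y -> ge 1 (x - y) -> x = y.
Proof.
by move=> /residues_id[_ {2}<-] /residues_id[_ {2}<-] /residue_congr.
Qed.

Lemma residues_residue x : ge 0 x -> residues (residue x).
Proof. by move=> hx; exists x. Qed.

Hypothesis finK : finite_set (int_quot v (maximal_ideal v)).

Definition residue_card : nat := #|` fset_set residues|%fset.

Lemma coset_eq n x y :
  [set x + z | z in val_ge v n] = [set y + z | z in val_ge v n] <-> ge n (x - y).
Proof.
split=> [h|h].
  have : [set y + z | z in val_ge v n] x.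
    by rewrite -h; exists 0; rewrite ?addr0//; exact: val_ge0.
  by move=> [z hz <-]; rewrite addrC addKr.
apply/seteqP; split=> _ [z hz <-].
  by exists (x - y + z); [exact: val_geD|ring].
by exists (y - x + z); [apply: val_geD => //; exact: val_ge_subC|ring].
Qed.

Lemma card_int_quot_residues : int_quot v (maximal_ideal v) #= residues.
Proof.
apply: card_image_congr => x y hx hy; rewrite coset_eq.
by split; [exact: residue_congr|exact: residue_inj].
Qed.

Lemma finite_residues : finite_set residues.
Proof. by rewrite -(eq_finite_set card_int_quot_residues). Qed.

Lemma card_residues : residues #= `I_residue_card.
Proof. exact/finite_card_eq/finite_residues. Qed.

Lemma in_residues x : (x \in fset_set residues) = (x \in residues).
Proof. by rewrite in_fset_set//; exact: finite_residues. Qed.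

Lemma val_ge1_prime x y : ge 0 x -> ge 0 y -> ge 1 (x * y) -> ge 1 x \/ ge 1 y.
Proof.
have [->|x0] := eqVneq x 0; first by left; exact: val_ge0.
have [->|y0] := eqVneq y 0; first by right; exact: val_ge0.
by rewrite !val_geE ?mulf_neq0// dvalM//; vlia.
Qed.

Lemma not_val_ge1_one : ~ ge 1 1.
Proof. by rewrite val_geE ?oner_neq0// dval1. Qed.

Hypothesis completeK : forall s, cauchy_seq v s -> exists x, converges_to v s x.
Hypothesis two_neq0 : (2 : K) != 0.

(** For [0 < e] squaring is additive modulo the maximal ideal, hence injective on residues, hence
    onto by finiteness. *)
Lemma residue_sqrt x : 0 < e -> ge 0 x -> exists2 y, ge 0 y & ge 1 (x - y ^+ 2).
Proof.
move=> e0 hx; have g2 : ge 1 2 by rewrite val_geE//; vlia.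
have X2 y : ge 0 y -> ge 0 (y ^+ 2) by move=> h; exact: val_geX2 h.
have [|||y yX h] :=
  @surj_of_inj _ (fset_set residues) (fun y => residue (y ^+ 2)) _ _ (residue x).
- move=> y; rewrite !in_residues !inE => /residues_id[y0 _].
  by apply: residues_residue; exact: X2.
- move=> y z; rewrite !in_residues !inE => hy hz.
  have [y0 _] := residues_id hy; have [z0 _] := residues_id hz.
  move=> /residue_inj => /(_ (X2 _ y0) (X2 _ z0)) h.
  apply: residues_inj => //.
  have : ge 1 ((y - z) * (y - z)).
    have -> : (y - z) * (y - z) = y ^+ 2 - z ^+ 2 - 2 * (z * (y - z)) by ring.
    apply: val_geB => //; apply: (val_geM_le _ g2 (val_geM z0 (val_geB y0 z0))); vlia.
  by move=> /val_ge1_prime[] //; apply: val_geB.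
- by rewrite in_residues inE; exact: residues_residue.
move: yX; rewrite in_residues inE => /residues_id[y0 _].
by exists y => //; exact: residue_inj hx (X2 _ y0) h.
Qed.

Lemma is_square_artin_schreier c w : 0 < e -> ge 0 c -> ge 0 w ->
  ge 1 (c - (w ^+ 2 + w)) -> is_square (1 + 4 * c).
Proof.
move=> e0 hc hw h; have g4 : ge (2 * e) 4 by rewrite -val_four//; exact: val_ge_self.
have [d0 vd] : 1 + 4 * c != 0 /\ v (1 + 4 * c) = 0.
  by apply: val_one_add; apply: (val_geM_le _ g4 hc); vlia.
apply: (@is_square_near _ v completeK two_neq0 _ (1 + 2 * w)) => //.
have -> : 1 + 4 * c - (1 + 2 * w) ^+ 2 = 4 * (c - (w ^+ 2 + w)) by ring.
by rewrite vd; apply: (val_geM_le _ g4 h); vlia.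
Qed.

(** Values at x and y agree exactly when (x - y)(x + y + 1) vanishes in the residue field, so a
    fibre lies in {x, -1 - x}. *)
Lemma artin_schreier_two_to_one c : ge 0 c ->
  {in fset_set residues,
    forall x, residue (x ^+ 2 + x + c) \in fset_set residues} /\
  (forall x y z, x \in fset_set residues -> y \in fset_set residues ->
    z \in fset_set residues ->
    residue (x ^+ 2 + x + c) = residue (y ^+ 2 + y + c) ->
    residue (x ^+ 2 + x + c) = residue (z ^+ 2 + z + c) ->
    [\/ x = y, y = z | x = z]).
Proof.
move=> hc.
have X2 y : ge 0 y -> ge 0 (y ^+ 2 + y + c).
  by move=> h; do 2!apply: val_geD => //; exact: val_geX2 h.
split=> [x|x y z]; rewrite !in_residues !inE.
  by move=> /residues_id[x0 _]; apply: residues_residue; exact: X2.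
move=> hx hy hz.
have key a b : residues a -> residues b ->
    residue (a ^+ 2 + a + c) = residue (b ^+ 2 + b + c) ->
    a = b \/ ge 1 (a + b + 1).
  move=> ha hb; have [a0 _] := residues_id ha; have [b0 _] := residues_id hb.
  move=> /residue_inj => /(_ (X2 _ a0) (X2 _ b0)).
  have -> : a ^+ 2 + a + c - (b ^+ 2 + b + c) = (a - b) * (a + b + 1) by ring.
  case/val_ge1_prime; [exact: val_geB| |left|right=> //]; last exact: residues_inj.
  exact: (val_geD (val_geD a0 b0) (val_ge1 v)).
move=> /key[]// => [|h1]; first by move=> ->; constructor.
move=> /key[]// => [|h2]; first by move=> ->; constructor.
constructor 2; apply: residues_inj => //.
by have := val_geB h1 h2; congr (ge 1 _); ring.
Qed.

Lemma unit_sqr_two_to_one u : e = 0 -> u != 0 -> v u = 0 ->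
  let X := (fset_set residues `\ residue 0%R)%fset in
  {in X, forall x, residue (u * x ^+ 2) \in X} /\
  (forall x y z, x \in X -> y \in X -> z \in X ->
    residue (u * x ^+ 2) = residue (u * y ^+ 2) ->
    residue (u * x ^+ 2) = residue (u * z ^+ 2) ->
    [\/ x = y, y = z | x = z]).
Proof.
move=> e0 u0 vu X; have gu : ge 0 u by rewrite val_geE// vu.
have X2 y : ge 0 y -> ge 0 (u * y ^+ 2).
  by move=> h; apply: (val_geM_le _ gu (val_geX2 h)); vlia.
have uK a : ge 1 (u * a) -> ge 1 a.
  by move=> h; apply/(@val_geMl _ v _ _ _ u0); rewrite vu add0r.
have nu x : x \in X -> [/\ residues x, ge 0 x & ~ ge 1 x].
  rewrite in_fsetD1 in_residues => /andP[/eqP x0 /set_mem hx].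
  have [? xid] := residues_id hx; split=> // h; apply: x0.
  by rewrite -xid; apply: residue_congr; rewrite subr0.
split=> [x|x y z] /nu[hx x0 x1].
  rewrite in_fsetD1 in_residues; apply/andP; split; last exact/mem_set/residues_residue/X2.
  apply/eqP => /residue_inj => /(_ (X2 _ x0) (val_ge0 _ _)).
  by rewrite subr0 => /uK/val_ge1_prime => /(_ x0 x0)[].
move=> /nu[hy y0 y1] /nu[hz z0 z1].
have key a b : residues a -> residues b -> ge 0 a -> ge 0 b ->
    residue (u * a ^+ 2) = residue (u * b ^+ 2) -> a = b \/ ge 1 (a + b).
  move=> ha hb a0 b0 /residue_inj => /(_ (X2 _ a0) (X2 _ b0)).
  have -> : u * a ^+ 2 - u * b ^+ 2 = u * ((a - b) * (a + b)) by ring.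
  move/uK; case/val_ge1_prime; [exact: val_geB|exact: val_geD|left|by right].
  exact: residues_inj.
move=> /key[]// => [|h1]; first by move=> ->; constructor.
move=> /key[]// => [|h2]; first by move=> ->; constructor.
constructor 2; apply: residues_inj => //.
by have := val_geB h1 h2; congr (ge 1 _); ring.
Qed.

Lemma residue_units x : x \in (fset_set residues `\ residue 0%R)%fset ->
  [/\ residues x, x != 0 & v x = 0].
Proof.
rewrite in_fsetD1 in_residues => /andP[/eqP x0 /set_mem hx].
have [g0 xid] := residues_id hx.
have ng : ~ ge 1 x.
  by move=> h; apply: x0; rewrite -xid; apply: residue_congr; rewrite subr0.
have [nx vx] := not_val_ge ng; split=> //.
by move: g0; rewrite val_geE//; vlia.
Qed.

Lemma residue_in_units x : ge 0 x -> ~ ge 1 x ->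
  residue x \in (fset_set residues `\ residue 0%R)%fset.
Proof.
move=> h0 h1; rewrite in_fsetD1 in_residues; apply/andP; split.
  by apply/eqP => /(residue_inj h0 (val_ge0 _ _)); rewrite subr0.
exact/mem_set/residues_residue.
Qed.

(** A non-injective self-map of a finite set misses a value. For [e = 0], squaring of nonzero
    residues identifies 1 and -1; for [0 < e], the map x^2 + x identifies 0 and -1, and a missed
    value [c] makes [1 + 4 * c] a nonsquare. *)
Lemma exists_unramified_nonsquare :
  exists ep : K, [/\ ep != 0, v ep = 0, ge (2 * e) (ep - 1) & ~ is_square ep].
Proof.
have e_ge0 := val_two_ge0 v two_neq0.
have N1 : ge 0 (-1) by apply: val_geN; exact: val_ge1.
have [e0|e0] : e = 0 \/ 0 < e by vlia.
  have [maps _] := unit_sqr_two_to_one e0 (oner_neq0 K) (dval1 v).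
  have [||||u uX hu] := nonsurj_of_noninj (a := residue 1) (b := residue (-1)) maps.
  - by apply: residue_in_units; [exact: val_ge1|exact: not_val_ge1_one].
  - apply: residue_in_units => // /val_geN; rewrite opprK; exact: not_val_ge1_one.
  - apply/eqP => /residue_inj => /(_ (val_ge1 _) N1).
    by rewrite opprK val_geE// e0.
  - have h1 := residueP (val_ge1 v); have hN := residueP N1.
    apply: residue_congr; rewrite !mul1r.
    have -> : residue 1 ^+ 2 - residue (-1) ^+ 2 =
      (-1 - residue (-1)) * (residue (-1) - 1) - (1 - residue 1) * (residue 1 + 1) by ring.
    case: h1 hN => a1 a2 [b1 b2]; apply: val_geB.
      by apply: (val_geM_le _ b2 (val_geB b1 (val_ge1 v))).
    by apply: (val_geM_le _ a2 (val_geD a1 (val_ge1 v))).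
  have [ru u0 vu] := residue_units uX.
  exists u; split=> //.
    by rewrite e0; apply: val_geB; [rewrite val_geE// vu|exact: val_ge1].
  move=> [y y0 uy]; have vy : v y = 0 by move: vu; rewrite uy dvalX2//; vlia.
  have gy : ge 0 y by rewrite val_geE// vy.
  have [gr hr] := residueP gy.
  apply: (hu (residue y)).
    apply: residue_in_units => //; rewrite val_geE// vy//.
  rewrite mul1r; have [_ <-] := residues_id ru; apply: residue_congr; rewrite uy.
  have -> : residue y ^+ 2 - y ^+ 2 = - ((y - residue y) * (residue y + y)) by ring.
  by apply: val_geN; apply: (val_geM_le _ hr (val_geD gr gy)).
have [maps _] := artin_schreier_two_to_one (val_ge0 v 0).
have [||||c cX hc] := nonsurj_of_noninj (a := residue 0) (b := residue (-1)) maps.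
- by rewrite in_residues inE; apply: residues_residue; exact: val_ge0.
- by rewrite in_residues inE; apply: residues_residue.
- apply/eqP => /residue_inj => /(_ (val_ge0 _ _) N1).
  by rewrite opprK add0r; exact: not_val_ge1_one.
- have [a1 a2] := residueP (val_ge0 v 0); have [b1 b2] := residueP N1.
  apply: residue_congr.
  have -> : residue 0 ^+ 2 + residue 0 + 0 - (residue (-1) ^+ 2 + residue (-1) + 0)
    = (-1 - residue (-1)) * residue (-1) - (0 - residue 0) * (residue 0 + 1) by ring.
  apply: val_geB; first by apply: (val_geM_le _ b2 b1).
  by apply: (val_geM_le _ a2 (val_geD a1 (val_ge1 v))).
rewrite in_residues inE in cX; have [gc cid] := residues_id cX.
have g4 : ge (2 * e) (4 * c).
  by rewrite -[2 * e]addr0 -val_four// val_geMl ?four_neq0.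
have [d0 vd] : 1 + 4 * c != 0 /\ v (1 + 4 * c) = 0.
  by apply: val_one_add; apply: val_ge_le g4; vlia.
exists (1 + 4 * c); split=> //; first by rewrite addrC addKr.
(* Solving [y = 1 + 2 * x] turns a square root of [1 + 4 * c] into a root of x(x + 1) = c, which is
   necessarily integral. *)
move=> [y y0 ey]; pose x := (y - 1) / 2.
have xc : x * (x + 1) = c.
  have -> : c = (y ^+ 2 - 1) / 4 by rewrite -ey; field; rewrite four_neq0.
  by rewrite /x; field; rewrite four_neq0.
clearbody x.
have gx : ge 0 x.
  apply: contrapT => /not_val_ge[x0 vx].
  have [|x1 vx1] := @val_add_dominant _ v x 1 x0.
    by rewrite val_geE ?oner_neq0// dval1; vlia.
  by move: gc; rewrite -xc val_geE ?mulf_neq0// dvalM// vx1; vlia.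
have [gr hr] := residueP gx.
apply: (hc (residue x)); first by rewrite in_residues inE; exact: residues_residue.
rewrite -[RHS]cid; apply: residue_congr; rewrite -xc.
have -> : residue x ^+ 2 + residue x + 0 - x * (x + 1) =
  - ((x - residue x) * (x + residue x + 1)) by ring.
apply: val_geN; apply: (val_geM_le _ hr (val_geD (val_geD gx gr) (val_ge1 v))); vlia.
Qed.

(** For [e = 0], two of the sets x^2, d x^2, d' x^2 of nonzero residues meet, so one of d, d', d d'
    is a square. For [0 < e] the same works with x^2 + x shifted by 0, c, c', where d = 1 + 4c and
    d' = 1 + 4c'. *)
Lemma unramified_nonsquareM d d' : d != 0 -> d' != 0 -> v d = 0 -> v d' = 0 ->
  ge (2 * e) (d - 1) -> ge (2 * e) (d' - 1) ->
  ~ is_square d -> ~ is_square d' -> is_square (d * d').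
Proof.
move=> d0 d'0 vd vd' hd hd' nd nd'; have e_ge0 := val_two_ge0 v two_neq0.
have [e0|e0] : e = 0 \/ 0 < e by vlia.
  have u1 : residue 1 \in (fset_set residues `\ residue 0%R)%fset.
    by apply: residue_in_units; [exact: val_ge1|exact: not_val_ge1_one].
  have near a b c : a != 0 -> v a = 0 -> c != 0 -> v c = 0 ->
      ge 1 (a * c ^+ 2 - b ^+ 2) -> is_square a.
    move=> a0 va c0 vc h; apply: (@is_square_near _ v completeK two_neq0 _ (b / c)) => //.
    have -> : a - (b / c) ^+ 2 = (a * c ^+ 2 - b ^+ 2) / c ^+ 2 by field.
    have c20 : c ^+ 2 != 0 by rewrite expf_neq0.
    by have := val_geV c20 (dvalX2 v c0) h; apply: val_ge_le; vlia.
  have ge0u a : a != 0 -> v a = 0 -> ge 0 a by move=> a0 va; rewrite val_geE// va.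
  have [|x [y [xX yX]]] := three_two_to_one_meet
      (f := fun x => residue (1 * x ^+ 2)) (g := fun x => residue (d * x ^+ 2))
      (h := fun x => residue (d' * x ^+ 2)) u1.
    by move=> k [->|[->|->]]; apply: unit_sqr_two_to_one; rewrite ?oner_neq0 ?dval1.
  have [_ x0 vx] := residue_units xX; have [_ y0 vy] := residue_units yX.
  have gu a z : a != 0 -> v a = 0 -> z != 0 -> v z = 0 -> ge 0 (a * z ^+ 2).
    move=> a0 va z0 vz; rewrite val_geE ?mulf_neq0 ?expf_neq0//.
    by rewrite dvalM ?expf_neq0// dvalX2//; vlia.
  case=> /residue_inj => /(_ (gu _ _ _ _ _ _) (gu _ _ _ _ _ _)) h.
  - case: nd; apply: (near d x y) => //; apply: val_ge_subC.
    by rewrite -[x ^+ 2]mul1r; apply: h; rewrite ?oner_neq0 ?dval1.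
  - case: nd'; apply: (near d' x y) => //; apply: val_ge_subC.
    by rewrite -[x ^+ 2]mul1r; apply: h; rewrite ?oner_neq0 ?dval1.
  - apply: (near (d * d') (d' * y) x); rewrite ?mulf_neq0// ?dvalM// ?vd ?vd'//.
    have -> : d * d' * x ^+ 2 - (d' * y) ^+ 2 = d' * (d * x ^+ 2 - d' * y ^+ 2) by ring.
    apply: (val_geM_le _ (ge0u _ d'0 vd') (h _ _ _ _ _ _ _ _)) => //; vlia.
have f0 := four_neq0 two_neq0.
have dE a : ge (2 * e) (a - 1) -> exists2 c, ge 0 c & a = 1 + 4 * c.
  move=> h; exists ((a - 1) / 4); last by field.
  have := val_geV f0 (val_four v two_neq0) h.
  by rewrite subrr.
have [c gc dc] := dE d hd; have [c' gc' dc'] := dE d' hd'.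
have g2 : ge 1 2 by rewrite val_geE//; vlia.
have r0 : residue 0 \in fset_set residues.
  by rewrite in_residues inE; apply: residues_residue; exact: val_ge0.
have [|x [y [xX yX]]] := three_two_to_one_meet
    (f := fun x => residue (x ^+ 2 + x + 0)) (g := fun x => residue (x ^+ 2 + x + c))
    (h := fun x => residue (x ^+ 2 + x + c')) r0.
  by move=> k [->|[->|->]]; apply: artin_schreier_two_to_one => //; exact: val_ge0.
move: xX yX; rewrite !in_residues !inE => /residues_id[gx _] /residues_id[gy _].
have gw := val_geB gx gy.
have X2 a b : ge 0 a -> ge 0 b -> ge 0 (a ^+ 2 + a + b).
  by move=> ha hb; do 2!apply: val_geD => //; exact: val_geX2 ha.
have two0 a : ge 0 a -> ge 1 (2 * a) by move=> ha; apply: (val_geM_le _ g2 ha).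
have X20 a : ge 0 a -> ge 0 (a ^+ 2) by move=> h; exact: val_geX2 h.
have key b : ge 0 b -> residue (x ^+ 2 + x + 0) = residue (y ^+ 2 + y + b) ->
    is_square (1 + 4 * b).
  move=> gb /residue_inj => /(_ (X2 _ _ gx (val_ge0 _ _)) (X2 _ _ gy gb)) h.
  apply: (is_square_artin_schreier (w := x - y)) => //.
  have -> : b - ((x - y) ^+ 2 + (x - y)) =
    2 * (y * (x - y)) - (x ^+ 2 + x + 0 - (y ^+ 2 + y + b)) by ring.
  by apply: val_geB => //; apply: two0; exact: val_geM gy gw.
case; [by move=> /(key _ gc); rewrite -dc|by move=> /(key _ gc'); rewrite -dc'|].
move=> /residue_inj => /(_ (X2 _ _ gx gc) (X2 _ _ gy gc')) h.
(* Modulo the maximal ideal the parameters simply add, since the term with [c * c'] is divisible by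
   4. *)
have -> : d * d' = 1 + 4 * (c + c' + 2 * (2 * (c * c'))) by rewrite dc dc'; ring.
have gcc := val_geM gc gc'.
apply: (is_square_artin_schreier (w := x - y)) => //.
  apply: val_geD; first exact: val_geD.
  by apply: (val_geM_le _ g2 (two0 _ gcc)).
have -> : c + c' + 2 * (2 * (c * c')) - ((x - y) ^+ 2 + (x - y)) =
  (x ^+ 2 + x + c - (y ^+ 2 + y + c')) +
  2 * (c' + 2 * (c * c') - x ^+ 2 + x * y - x + y) by ring.
have g2cc : ge 0 (2 * (c * c')) by apply: val_ge_le (two0 _ gcc).
apply: val_geD => //; apply: two0.
by do ![apply: val_geB|apply: val_geD|apply: X20] => //; exact: val_geM gx gy.
Qed.

End Residue.

(** * Norms from quadratic extensions and levels of squares *)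

Section NormForms.
Variable K : fieldType.
Hypothesis two_neq0 : (2 : K) != 0.
Implicit Types (x y z a b al be : K).

Definition is_norm be al : Prop := exists x y, al = x ^+ 2 - be * y ^+ 2.

Lemma is_normM be al al' : is_norm be al -> is_norm be al' -> is_norm be (al * al').
Proof.
move=> [x [y ->]] [x' [y' ->]].
by exists (x * x' + be * y * y'), (x * y' + y * x'); ring.
Qed.

Lemma is_norm_sqr be z : is_norm be (z ^+ 2).
Proof. by exists z, 0; ring. Qed.

Lemma is_norm1 be : is_norm be 1.
Proof. by rewrite -(expr1n _ 2); exact: is_norm_sqr. Qed.

Lemma is_square_norm be al : is_square al -> is_norm be al.
Proof. by move=> [y _ ->]; exact: is_norm_sqr. Qed.

Lemma is_norm_opp be : is_norm be (- be).
Proof. by exists 0, 1; ring. Qed.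

Lemma is_norm_one_sub be : is_norm be (1 - be).
Proof. by exists 1, 1; ring. Qed.

Lemma is_norm_cancel be al nu : nu != 0 -> is_norm be nu ->
  is_norm be (al * nu) -> is_norm be al.
Proof.
move=> nu0 hnu h; have -> : al = al * nu * nu * nu^-1 ^+ 2 by field.
apply: is_normM (is_norm_sqr _ _); exact: is_normM.
Qed.

(** The norm form splits as (x - z y)(x + z y); the witnesses make the factors 1 and [al]. *)
Lemma is_norm_of_square be al : is_square be -> is_norm be al.
Proof.
move=> [z z0 ->]; exists ((al + 1) / 2), ((al - 1) / (2 * z)).
by field; rewrite z0.
Qed.

Lemma is_norm_sqrr be al z : z != 0 -> is_norm (be * z ^+ 2) al <-> is_norm be al.
Proof.
move=> z0; split=> -[x [y ->]]; first by exists x, (z * y); ring.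
by exists x, (y / z); field.
Qed.

Lemma is_norm_sqrl be al z : z != 0 -> is_norm be (al * z ^+ 2) <-> is_norm be al.
Proof.
move=> z0; split=> h; last exact: is_normM (is_norm_sqr _ _).
by apply: is_norm_cancel h; [rewrite expf_neq0|exact: is_norm_sqr].
Qed.

Lemma is_norm_sym be al : be != 0 -> al != 0 -> is_norm be al -> is_norm al be.
Proof.
move=> be0 al0 [x [y E]]; have [y0|y0] := eqVneq y 0.
  apply: is_norm_of_square; exists x; last by rewrite E y0; ring.
  by apply: contraNneq al0 => x0; rewrite E x0 y0; apply/eqP; ring.
by exists (x / y), y^-1; rewrite E; field.
Qed.

(** A nontrivial zero with [x != 0] scales to x = 1; one with [x = 0] forces [be] to be a square,
    and then everything is a norm. *)
Lemma hilbert_norm al be : al != 0 -> be != 0 ->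
  hilbert al be = if `[< is_norm be al >] then 1 else -1.
Proof.
move=> al0 be0; rewrite /hilbert; congr (if _ then _ else _).
apply: asbool_equiv_eq; split=> [[x [y [z [nz E]]]]|[x [y E]]]; last first.
  exists 1, y, x; split; last by rewrite E; ring.
  by rewrite !xpair_eqE oner_eq0.
have [x0|x0] := eqVneq x 0; last first.
  exists (z / x), (y / x).
  have -> : al = al * x ^+ 2 / x ^+ 2 by field.
  have -> : al * x ^+ 2 = z ^+ 2 - be * y ^+ 2 by rewrite E; ring.
  by field.
have {}E : z ^+ 2 = be * y ^+ 2 by rewrite E x0; ring.
have y0 : y != 0.
  apply: contraNneq nz => y0; rewrite x0 y0 !xpair_eqE !eqxx /=.
  by rewrite -sqrf_eq0 E y0; apply/eqP; ring.
have z0 : z != 0 by rewrite -sqrf_eq0 E mulf_neq0 ?expf_neq0.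
apply: is_norm_of_square; exists (z / y); first by rewrite mulf_neq0 ?invr_eq0.
by rewrite expr_div_n E; field.
Qed.

(* A root x of b x^2 - 2 x + a exhibits 1 + a as (1 + x)^2 - (1 + b) x^2. *)
Lemma is_norm_one_add a b : is_square (1 - a * b) -> is_norm (1 + b) (1 + a).
Proof.
suff key r : 1 + r != 0 -> 1 - a * b = r ^+ 2 -> is_norm (1 + b) (1 + a).
  (* Both signs of the square root are available; [r = -1] is replaced by 1. *)
  move=> [r _ E]; have [r1|] := eqVneq (1 + r) 0; last by move=> /key; apply.
  apply: (key 1) => //; rewrite E.
  have -> : r = -1 by apply/eqP; rewrite -addr_eq0 addrC r1.
  by ring.
(* This is the root (1 - r)/b, rewritten so that [b = 0] is allowed. *)
move=> r0 E; pose x := a / (1 + r); exists (1 + x), x.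
have e1 : a - 2 * x + b * x ^+ 2 = 0.
  have -> : a - 2 * x + b * x ^+ 2 =
      a / (1 + r) ^+ 2 * (r ^+ 2 - (1 - a * b)) by rewrite /x; field.
  by rewrite E subrr mulr0.
apply/eqP; rewrite -subr_eq0; apply/eqP.
by rewrite -[RHS]e1; ring.
Qed.

End NormForms.

(** * The filtration of the square classes and norms from the unramified extension *)

Section Levels.
Variables (K : fieldType) (v : discrete_valuation K).
Local Notation ge := (val_ge v).
Local Notation e := (v 2).
Implicit Types (i j l m n r : int) (x y z a b d u al be : K).

Definition even_val d : Prop := exists h : int, v d = 2 * h.

(** The precision is relative to [v d], which makes the notion invariant under multiplying [d] by
    squares. *)
Definition square_mod r d : Prop := exists b, ge (v d + r) (d - b ^+ 2).

(* The filtration of K^* by congruence to squares, extended to all integers: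
   everything for i < 0, even valuation for i = 0, squares for i > v 2. *)
Definition square_level i d : Prop := 0 <= i -> even_val d /\ square_mod (2 * i) d.

Lemma even_valP d : (exists h : int, v d = 2 * h) \/ (exists h : int, v d = 2 * h + 1).
Proof.
have [] : ((v d %% 2)%Z = 0 \/ (v d %% 2)%Z = 1) by vlia.
  by left; exists (v d %/ 2)%Z; vlia.
by right; exists (v d %/ 2)%Z; vlia.
Qed.

Lemma even_val_sqr d z : d != 0 -> z != 0 -> even_val (d * z ^+ 2) <-> even_val d.
Proof.
move=> d0 z0; rewrite /even_val dvalM ?expf_neq0// dvalX2//.
by split=> -[h ?]; [exists (h - v z)|exists (h + v z)]; vlia.
Qed.

Lemma square_mod_sqr r d z : d != 0 -> z != 0 ->
  square_mod r (d * z ^+ 2) <-> square_mod r d.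
Proof.
move=> d0 z0; have z20 : z ^+ 2 != 0 by rewrite expf_neq0.
have E : v (d * z ^+ 2) + r = v (z ^+ 2) + (v d + r) by rewrite dvalM//; vlia.
rewrite /square_mod E; split=> -[b hb].
  exists (b / z); apply/(@val_geMl _ v _ _ _ z20).
  by have -> : z ^+ 2 * (d - (b / z) ^+ 2) = d * z ^+ 2 - b ^+ 2 by field.
exists (b * z); have -> : d * z ^+ 2 - (b * z) ^+ 2 = z ^+ 2 * (d - b ^+ 2) by ring.
exact/val_geMl.
Qed.

Lemma square_level_sqr i d z : d != 0 -> z != 0 ->
  square_level i (d * z ^+ 2) <-> square_level i d.
Proof.
by move=> d0 z0; rewrite /square_level even_val_sqr// square_mod_sqr.
Qed.

Lemma square_mod_le r r' d : r <= r' -> square_mod r' d -> square_mod r d.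
Proof. by move=> h [b hb]; exists b; apply: val_ge_le hb; vlia. Qed.

Lemma square_level_le i j d : i <= j -> square_level j d -> square_level i d.
Proof.
move=> ij h i0; have [? h'] := h (le_trans i0 ij); split=> //.
by apply: square_mod_le h'; vlia.
Qed.

Lemma square_mod_even r d : 0 < r -> d != 0 -> square_mod r d -> even_val d.
Proof.
move=> r0 d0 [b hb]; have [] : b ^+ 2 != 0 /\ v (b ^+ 2) = v d.
  by apply: val_congr => //; apply: val_ge_subC; apply: val_ge_le hb; vlia.
by rewrite expf_eq0 /= => b0; rewrite dvalX2// => vb; exists (v b).
Qed.

Lemma square_mod_nonpos r d : r <= 0 -> square_mod r d.
Proof.
move=> r0; exists 0; have -> : d - 0 ^+ 2 = d by ring.
by apply: val_ge_self_le; vlia.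
Qed.

Lemma square_level_unit i u : u != 0 -> v u = 0 -> ge (2 * i) (u - 1) -> square_level i u.
Proof.
move=> u0 vu h _; split; first by exists 0.
by exists 1; rewrite vu add0r expr1n.
Qed.

Lemma square_mod_normal r d : 0 < r -> d != 0 -> square_mod r d ->
  exists z a, [/\ z != 0, ge r a & d = (1 + a) * z ^+ 2].
Proof.
move=> r0 d0 [b hb]; have [] : b ^+ 2 != 0 /\ v (b ^+ 2) = v d.
  by apply: val_congr => //; apply: val_ge_subC; apply: val_ge_le hb; vlia.
move=> b20 vb; have b0 : b != 0 by move: b20; rewrite expf_eq0.
exists b, ((d - b ^+ 2) / b ^+ 2); split=> //; last by field.
by have := val_geV b20 vb hb; apply: val_ge_le; vlia.
Qed.

Lemma even_val_normal d : d != 0 -> even_val d ->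
  exists z u, [/\ z != 0, u != 0, v u = 0 & d = u * z ^+ 2].
Proof.
move=> d0 [h vh]; have [p p0 vp] := val_surj v h.
have p20 : p ^+ 2 != 0 by rewrite expf_neq0.
exists p, (d / p ^+ 2); split=> //; first by rewrite mulf_neq0 ?invr_eq0.
  by rewrite dvalM ?invr_eq0// dvalV// dvalX2// vp; vlia.
by field.
Qed.

Lemma square_level_normal i d : 0 <= i -> d != 0 -> square_level i d ->
  exists z u, [/\ z != 0, u != 0, v u = 0, ge (2 * i) (u - 1) & d = u * z ^+ 2].
Proof.
move=> i0 d0 /(_ i0)[ed sd]; have [->|{}i0] : i = 0 \/ 0 < i by vlia.
  have [z [u [z0 u0 vu ->]]] := even_val_normal d0 ed; exists z, u; split=> //.
  by apply: val_geB; [rewrite val_geE// vu|exact: val_ge1].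
have [|z [a [z0 ha ->]]] := square_mod_normal _ d0 sd; first by vlia.
have [|? ?] := @val_one_add _ v a; first by apply: val_ge_le ha; vlia.
by exists z, (1 + a); split=> //; rewrite addrC addKr.
Qed.

Hypothesis localK : nonarch_local_field v.
Hypothesis two_neq0 : (2 : K) != 0.

Let completeK := localK.1.
Let finK := localK.2.

Lemma square_mod_square r d : 2 * e < r -> d != 0 -> square_mod r d <-> is_square d.
Proof.
move=> re d0; split=> [[b hb]|[b _ ->]]; last first.
  by exists b; rewrite subrr; exact: val_ge0.
by apply: (is_square_near completeK two_neq0 d0 (b := b)); apply: val_ge_le hb; vlia.
Qed.

Lemma square_level_square i d : e < i -> d != 0 -> square_level i d <-> is_square d.
Proof.
move=> ie d0; have e0 := val_two_ge0 v two_neq0.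
split=> [/(_ _)[|_]|sd _]; first by vlia.
  by rewrite square_mod_square//; vlia.
split; last by apply/square_mod_square => //; vlia.
by case: sd => y y0 ->; exists (v y); rewrite dvalX2.
Qed.

Lemma square_level_of_square i d : is_square d -> square_level i d.
Proof.
move=> sd; have d0 := is_square_neq0 sd; have e0 := val_two_ge0 v two_neq0.
apply: (@square_level_le _ (Num.max i (e + 1))); first by rewrite le_max lexx.
by apply/square_level_square => //; rewrite lt_max; apply/orP; right; vlia.
Qed.

(** Here the residue characteristic is 2, so the leading digit of u - 1 is a square y^2, and (1 + p
    y)^2 absorbs it: the cross term has valuation at least [e + i], hence above [2 * i]. This is why
    even precisions suffice for the filtration below [e]. *)
Lemma square_mod_succ i d : 0 <= i < e -> d != 0 -> square_level i d ->
  square_mod (2 * i + 1) d.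
Proof.
move=> /andP[i0 ie] d0 /(square_level_normal i0 d0)[z [u [z0 u0 vu hu ->]]].
apply/square_mod_sqr => //; have e0 : 0 < e by vlia.
have [p p0 vp] := val_surj v i; have p20 : p ^+ 2 != 0 by rewrite expf_neq0.
have [{}i0|{}i0] : i = 0 \/ 0 < i by vlia.
  have [|y _ hy] := residue_sqrt finK two_neq0 (x := u) e0; first by rewrite val_geE// vu.
  by exists y; rewrite vu i0.
have [|y gy hy] := residue_sqrt finK two_neq0 (x := (u - 1) / p ^+ 2) e0.
  by have := val_geV p20 (dvalX2 v p0) hu; apply: val_ge_le; vlia.
exists (1 + p * y); rewrite vu.
have -> : u - (1 + p * y) ^+ 2 = p ^+ 2 * ((u - 1) / p ^+ 2 - y ^+ 2) - 2 * (p * y).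
  by field.
have gp : ge i p by rewrite val_geE// vp.
apply: val_geB.
  apply: (val_geM_le _ (val_geX2 gp) hy); vlia.
by apply: (val_geM_le _ (val_ge_self v 2) (val_geM gp gy)); vlia.
Qed.

Lemma square_level_normal_succ i d : 0 <= i < e -> d != 0 -> square_level i d ->
  exists z a, [/\ z != 0, ge (2 * i + 1) a & d = (1 + a) * z ^+ 2].
Proof.
move=> ie d0 h; apply: square_mod_normal => //; last exact: square_mod_succ.
by vlia.
Qed.

(* A class of even valuation outside level j has a normal form 1 + b
   with v b odd, its quadratic defect. *)
Lemma odd_level_normal j d : 0 <= j <= e -> d != 0 -> even_val d ->
  ~ square_level j d -> exists z b i, [/\ z != 0, b != 0, d = (1 + b) * z ^+ 2,
    v b = 2 * i + 1 & 0 <= i < j].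
Proof.
move=> /andP[j0 je] d0 ed; case: j j0 je => // j _ je.
elim: j je => [_ h|j IH je nd].
  by case: h => _; split=> //; exact: square_mod_nonpos.
have [hd|/IH] := pselect (square_level j d); last first.
  case=> [|z [b [i [? ? ? ? ?]]]]; first by vlia.
  by exists z, b, i; split=> //; vlia.
have [|z [b [z0 hb E]]] := @square_level_normal_succ j d _ d0 hd; first by vlia.
have nb : ~ ge (2 * j.+1%:Z) b.
  move=> h; have [|b0 vb] := @val_one_add _ v b; first by apply: val_ge_le h; vlia.
  apply: nd; rewrite E; apply/square_level_sqr => //; apply: square_level_unit => //.
  by rewrite addrC addKr.
have [b0 vb] := not_val_ge nb; exists z, b, j%:Z; split=> //; last by vlia.
by move: hb; rewrite val_geE//; vlia.
Qed.

Lemma unramified_index2 d d' : d != 0 -> d' != 0 -> square_level e d ->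
  square_level e d' -> ~ is_square d -> ~ is_square d' -> is_square (d * d').
Proof.
move=> d0 d'0 hd hd' nd nd'; have e0 := val_two_ge0 v two_neq0.
have [z [u [z0 u0 vu hu E]]] := square_level_normal e0 d0 hd.
have [z' [u' [z'0 u'0 vu' hu' E']]] := square_level_normal e0 d'0 hd'.
have -> : d * d' = u * u' * (z * z') ^+ 2 by rewrite E E'; ring.
apply: is_squareM; last by apply: is_square_sqr; rewrite mulf_neq0.
apply: (unramified_nonsquareM finK completeK) => //.
  by move=> su; apply: nd; rewrite E; apply: is_squareM su _; exact: is_square_sqr.
by move=> su; apply: nd'; rewrite E'; apply: is_squareM su _; exact: is_square_sqr.
Qed.

(** Two of the integers 0, ..., q have the same residue; their difference is the witness. *)
Lemma exists_small_nat : exists2 n : nat, (0 < n)%N & ge 1 (n%:R : K).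
Proof.
apply: contrapT => no; pose q := #|` fset_set (residues v)|%fset.
have U : uniq [seq residue v (k%:R : K) | k <- iota 0 q.+1].
  rewrite map_inj_in_uniq ?iota_uniq// => m n _ _.
  wlog mn : m n / (m <= n)%N => [h|].
    by case: (leqP m n) => [/h|/ltnW /h h' /esym/h']//; apply.
  move=> /esym/residue_inj => /(_ (val_ge_nat _ _) (val_ge_nat _ _)) h.
  apply/eqP; rewrite eqn_leq mn /= leqNgt; apply/negP => lt; apply: no.
  by exists (n - m)%N; rewrite ?subn_gt0// natrB.
have := uniq_leq_size U (s2 := fset_set (residues v)).
rewrite size_map size_iota ltnn => H; apply: notF; apply: H => _ /mapP[n _ ->].
by rewrite in_residues//; apply/mem_set/residues_residue; exact: val_ge_nat.
Qed.

(* With odd residue characteristic and -1 not a square, some k is a square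
   while k + 1 is minus a square. *)
Lemma minus_one_sum_sqr : e = 0 -> ~ is_square (-1 : K) -> is_norm (-1 : K) (-1).
Proof.
move=> e0 n1; apply: contrapT => nn.
have N0 : (-1 : K) != 0 by rewrite oppr_eq0 oner_neq0.
have vN : v (-1) = 0 by rewrite dvalN ?oner_neq0// dval1.
have lev0 u : u != 0 -> v u = 0 -> square_level e u.
  move=> u0 vu; apply: square_level_unit => //; rewrite e0.
  by apply: val_geB; [rewrite val_geE// vu|exact: val_ge1].
(* If -1 were no sum of two squares, every positive integer would be a square unit, against
   [exists_small_nat]. *)
have P (n : nat) : is_square (n.+1%:R : K) /\ ~ ge 1 (n.+1%:R : K).
  elim: n => [|n [[t t0 tE] _]].
    split; last exact: not_val_ge1_one.
    by exists 1; rewrite ?oner_neq0// expr1n.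
  have ng : ~ ge 1 (n.+2%:R : K).
    move=> h; apply: n1; apply: (is_square_near completeK two_neq0 N0 (b := t)).
    rewrite vN e0; have -> : -1 - t ^+ 2 = - (n.+2%:R) by rewrite -tE -(natr1 n.+1); ring.
    exact: val_geN.
  split=> //; have [u0 vu] := not_val_ge ng.
  have {}vu : v (n.+2%:R) = 0.
    by have := val_ge_nat v n.+2; rewrite val_geE//; vlia.
  apply: contrapT => nu.
  have [s s0 sE] := unramified_index2 N0 u0 (lev0 _ N0 vN) (lev0 _ u0 vu) n1 nu.
  apply: nn; exists (t / s), (1 / s).
  have -> : (t / s) ^+ 2 - -1 * (1 / s) ^+ 2 = (t ^+ 2 + 1) / s ^+ 2 by field.
  have -> : t ^+ 2 + 1 = - s ^+ 2 by rewrite -sE -tE natr1; ring.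
  by field.
have [[//|n] _ h] := exists_small_nat.
by have [_] := P n; apply.
Qed.

(** For [0 < e], up to squares u = 1 + a with a in the maximal ideal and d = 1 + b with b divisible
    by 4, so 1 - a b is a square. For [e = 0], units modulo squares have order 2 and it remains to
    see that [d1] is a norm; as [- d1] always is, this reduces to -1. *)
Lemma unit_norm_of_unramified d u : d != 0 -> u != 0 -> square_level e d ->
  even_val u -> is_norm d u.
Proof.
move=> d0 u0 hd eu; have e_ge0 := val_two_ge0 v two_neq0.
have [z [d1 [z0 d10 vd1 hd1 ->]]] := square_level_normal e_ge0 d0 hd.
apply/is_norm_sqrr => //.
have [e0|e0] : e = 0 \/ 0 < e by vlia.
  have lev0 x : x != 0 -> v x = 0 -> square_level e x.
    move=> x0 vx; apply: square_level_unit => //; rewrite e0.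
    by apply: val_geB; [rewrite val_geE// vx|exact: val_ge1].
  have [w [u1 [w0 u10 vu1 ->]]] := even_val_normal u0 eu; apply/is_norm_sqrl => //.
  have [sd|nd] := pselect (is_square d1); first exact: is_norm_of_square.
  have [su|nu] := pselect (is_square u1); first exact: is_square_norm.
  have sdu := unramified_index2 d10 u10 (lev0 _ d10 vd1) (lev0 _ u10 vu1) nd nu.
  suff dd : is_norm d1 d1.
    apply: is_norm_cancel dd _ => //; apply: is_square_norm; by rewrite mulrC.
  have N0 : (-1 : K) != 0 by rewrite oppr_eq0 oner_neq0.
  have vN : v (-1) = 0 by rewrite dvalN ?oner_neq0// dval1.
  have [s1|n1] := pselect (is_square (-1 : K)).
    by have := is_normM (is_norm_opp d1) (is_square_norm d1 s1); rewrite mulrN1 opprK.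
  have [s s0 sE] := unramified_index2 N0 d10 (lev0 _ N0 vN) (lev0 _ d10 vd1) n1 nd.
  have -> : d1 = -1 * s ^+ 2 by rewrite -sE; ring.
  by apply/is_norm_sqrr => //; apply/is_norm_sqrl => //; exact: minus_one_sum_sqr.
have [||w [a [w0 ha ->]]] := @square_level_normal_succ 0 u _ u0; first by vlia.
  by move=> _; split=> //; exact: square_mod_nonpos.
apply/is_norm_sqrl => //.
have -> : d1 = 1 + (d1 - 1) by ring.
apply: is_norm_one_add => //.
have hab : ge (2 * e + 1) (a * (d1 - 1)) by apply: (val_geM_le _ ha hd1); vlia.
have [|n0 vn] := @val_one_add _ v (- (a * (d1 - 1))).
  by apply: val_geN; apply: val_ge_le hab; vlia.
apply: (is_square_near completeK two_neq0 n0 (b := 1)).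
have -> : 1 - a * (d1 - 1) - 1 ^+ 2 = - (a * (d1 - 1)) by ring.
rewrite vn; apply: val_geN.
by apply: val_ge_le hab; vlia.
Qed.

(** After scaling, the norm is w^2 - u with u - 1 divisible by 4. An odd valuation above [2 * e]
    would make [u] a square; an odd one below [2 * e] would be shared by w^2 - 1, against
    [val_sqr_sub1_odd]. *)
Lemma norm_of_unramified_even d al : d != 0 -> al != 0 -> square_level e d ->
  ~ is_square d -> is_norm d al -> even_val al.
Proof.
move=> d0 al0 hd nd; have e_ge0 := val_two_ge0 v two_neq0.
have [z [u [z0 u0 vu hu E]]] := square_level_normal e_ge0 d0 hd.
have nu : ~ is_square u.
  by move=> su; apply: nd; rewrite E; apply: is_squareM su _; exact: is_square_sqr.
rewrite E => /(is_norm_sqrr _ _ z0) [x [y alE]].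
have evX w : w != 0 -> even_val (w ^+ 2) by move=> w0; exists (v w); rewrite dvalX2.
have evu w : w != 0 -> even_val (- (u * w ^+ 2)).
  move=> w0; exists (v w); rewrite dvalN ?mulf_neq0 ?expf_neq0//.
  by rewrite dvalM ?expf_neq0// dvalX2// vu; vlia.
have [y0|y0] := eqVneq y 0.
  have {}alE : al = x ^+ 2 by rewrite alE y0; ring.
  by rewrite alE; apply: evX; apply: contraNneq al0 => x0; rewrite alE x0 expr0n.
have -> : al = ((x / y) ^+ 2 - u) * y ^+ 2 by rewrite alE; field.
have al10 : (x / y) ^+ 2 - u != 0.
  apply: contraNneq al0 => h; rewrite alE; apply/eqP.
  by rewrite -[RHS](mul0r (y ^+ 2)) -h; field.
apply/even_val_sqr => //; set w := x / y in al10 *.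
have [//|[n vn]] := even_valP (w ^+ 2 - u).
have w2 : w ^+ 2 - 1 = (w ^+ 2 - u) + (u - 1) by ring.
have [h|h] := leP (2 * n + 1) (2 * e); last first.
  case: nu; apply: (is_square_near completeK two_neq0 u0 (b := w)).
  by apply: val_ge_subC; rewrite val_geE// vu vn; vlia.
have [|n0 vw] := @val_add_dominant _ v _ (u - 1) al10.
  by apply: val_ge_le hu; rewrite vn; vlia.
rewrite -w2 in n0 vw; have := @val_sqr_sub1_odd _ v two_neq0 n w.
by rewrite vw => /(_ vn n0); vlia.
Qed.

End Levels.

(** * Index of norm groups, bilinearity of the Hilbert symbol, and exact annihilators *)

Section Duality.
Variables (K : fieldType) (v : discrete_valuation K).
Hypothesis localK : nonarch_local_field v.
Hypothesis two_neq0 : (2 : K) != 0.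
Local Notation ge := (val_ge v).
Local Notation e := (v 2).
Implicit Types (i j l m n r : int) (x y z a b c d u al be nu : K).

Let completeK := localK.1.
Let finK := localK.2.

(** The hypothesis on [k] and [a] cancels a digit at an odd position by a norm [1 + c]; digits at
    even positions are absorbed into squares by [square_mod_succ]. Alternating the two raises the
    level. *)
Lemma norm_reduction be i : 0 <= i <= e ->
  (forall k a, 0 <= k < i -> ge (2 * k + 1) a ->
    exists2 c, is_norm be (1 + c) & ge (2 * k + 2) (a + c)) ->
  forall al, al != 0 -> even_val v al ->
  exists nu, [/\ nu != 0, is_norm be nu & square_level v i (al * nu)].
Proof.
move=> /andP[i0 ie] step al al0 eal; case: i i0 ie step => // i _.
elim: i => [_ _|i IH ie step].
  exists 1; rewrite mulr1 oner_neq0; split=> //; first exact: is_norm1.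
  by move=> _; split=> //; exact: square_mod_nonpos.
have [||nu [nu0 hnu lnu]] := IH; [by vlia|by move=> k a hk; apply: step; vlia|].
have an0 : al * nu != 0 by rewrite mulf_neq0.
have [|z [a [z0 ha E]]] := square_level_normal_succ localK two_neq0 _ an0 lnu.
  by vlia.
have [|c hc hac] := step i%:Z a _ ha; first by vlia.
have gc : ge 1 c.
  have -> : c = a + c - a by ring.
  by apply: val_geB; [apply: val_ge_le hac|apply: val_ge_le ha]; vlia.
have [c0 vc] := val_one_add gc.
exists (nu * (1 + c)); split; [by rewrite mulf_neq0|exact: is_normM|].
have -> : al * (nu * (1 + c)) = (1 + (a + c + a * c)) * z ^+ 2.
  by rewrite mulrA E; ring.
have h : ge (2 * i.+1%:Z) (a + c + a * c).
  apply: val_geD; first by apply: val_ge_le hac; vlia.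
  by apply: (val_geM_le _ ha gc); vlia.
have [|n0 vn] := @val_one_add _ v (a + c + a * c); first by apply: val_ge_le h; vlia.
apply/square_level_sqr => //; apply: square_level_unit => //.
by rewrite addrC addKr.
Qed.

Lemma not_norm_mul be x nu : nu != 0 -> is_norm be nu -> ~ is_norm be x ->
  ~ is_norm be (x * nu).
Proof. by move=> n0 hn nx h; apply: nx; exact: is_norm_cancel h. Qed.

(** The norm [p] of odd valuation serves to make the valuation of [x] even, after which
    [norm_reduction] applies. *)
Lemma nonnorm_reduction be i (p : K) h : 0 <= i <= e ->
  (forall k a, 0 <= k < i -> ge (2 * k + 1) a ->
    exists2 c, is_norm be (1 + c) & ge (2 * k + 2) (a + c)) ->
  p != 0 -> is_norm be p -> v p = 2 * h + 1 ->
  forall x, x != 0 -> ~ is_norm be x -> exists nu, [/\ nu != 0, is_norm be nu,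
    square_level v i (x * nu) & ~ is_norm be (x * nu)].
Proof.
move=> ie step p0 hp vp x x0 nx.
have [n1 [n10 hn1 ev]] : exists nu, [/\ nu != 0, is_norm be nu & even_val v (x * nu)].
  have [ev|[k vx]] := even_valP v x.
    by exists 1; rewrite mulr1 oner_neq0; split=> //; exact: is_norm1.
  by exists p; split=> //; exists (h + k + 1); rewrite dvalM//; vlia.
have xn0 : x * n1 != 0 by rewrite mulf_neq0.
have [n2 [n20 hn2 lev]] := norm_reduction ie step xn0 ev.
have hn := is_normM hn1 hn2; have n0 : n1 * n2 != 0 by rewrite mulf_neq0.
exists (n1 * n2); rewrite mulrA; split=> //.
by rewrite -mulrA; exact: not_norm_mul.
Qed.

Lemma norm_mul_cancel be al al' nu nu' :
  nu != 0 -> nu' != 0 -> is_norm be nu -> is_norm be nu' ->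
  is_norm be ((al * nu) * (al' * nu')) -> is_norm be (al * al').
Proof.
move=> n0 n0' hn hn' h; apply: (@is_norm_cancel _ _ _ (nu * nu')).
- by rewrite mulf_neq0.
- exact: is_normM.
- by rewrite mulrACA.
Qed.

(** As [v be] is odd, the norms 1 - be y^2 reach every odd position below [2 * e]. Both non-norms
    thus reduce to nonsquares in level [e], where the product of two nonsquares is a square. *)
Lemma norm_index2_odd be al al' m : be != 0 -> v be = 2 * m + 1 ->
  al != 0 -> al' != 0 -> ~ is_norm be al -> ~ is_norm be al' -> is_norm be (al * al').
Proof.
move=> be0 vbe al0 al'0 nal nal'; have e_ge0 := val_two_ge0 v two_neq0.
have step k a : 0 <= k < e -> ge (2 * k + 1) a ->
    exists2 c, is_norm be (1 + c) & ge (2 * k + 2) (a + c).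
  move=> /andP[k0 ke] ha; have e0 : 0 < e by vlia.
  have [p p0 vp] := val_surj v (k - m).
  have bp0 : be * p ^+ 2 != 0 by rewrite mulf_neq0 ?expf_neq0.
  have vbp : v (be * p ^+ 2) = 2 * k + 1.
    by rewrite dvalM ?expf_neq0// dvalX2// vp vbe; vlia.
  have [|y gy hy] := residue_sqrt finK two_neq0 (x := a / (be * p ^+ 2)) e0.
    by have := val_geV bp0 vbp ha; rewrite subrr.
  exists (- (be * (p * y) ^+ 2)); first by exists 1, (p * y); ring.
  have -> : a - be * (p * y) ^+ 2 = be * p ^+ 2 * (a / (be * p ^+ 2) - y ^+ 2).
    by field; rewrite ?be0 ?p0.
  by apply: val_ge_le (val_geM (val_ge_self v _) hy); rewrite vbp; vlia.
have N0 : - be != 0 by rewrite oppr_eq0.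
have vN : v (- be) = 2 * m + 1 by rewrite dvalN.
have ee : 0 <= e <= e by rewrite e_ge0 lexx.
have red := nonnorm_reduction ee step N0 (is_norm_opp be) vN.
have [nu [n0 hn lev nn]] := red _ al0 nal.
have [nu' [n0' hn' lev' nn']] := red _ al'0 nal'.
apply: (norm_mul_cancel n0 n0' hn hn'); apply: is_square_norm.
apply: (unramified_index2 localK two_neq0) => //; rewrite ?mulf_neq0//.
  by move=> /(is_square_norm be).
by move=> /(is_square_norm be).
Qed.

(** The available norms are (1 + x)^2 - (1 + b)x^2 = 1 + 2x - b x^2. The term 2x is negligible
    against b x^2 of valuation [2 * k + 1] only for [k < e - i - 1], so the reduction stops at that
    level and leaves [1 + a] with [a] of valuation at least [2 * e - 2 * i - 1]. Then 1 - a b lies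
    in level [e], and is a nonsquare if [1 + a] is no norm. *)
Lemma norm_index2_defect b i al al' : b != 0 -> v b = 2 * i + 1 -> 0 <= i < e ->
  al != 0 -> al' != 0 -> ~ is_norm (1 + b) al -> ~ is_norm (1 + b) al' ->
  is_norm (1 + b) (al * al').
Proof.
move=> b0 vb /andP[i0 ie] al0 al'0 nal nal'.
have step k a : 0 <= k < e - i - 1 -> ge (2 * k + 1) a ->
    exists2 c, is_norm (1 + b) (1 + c) & ge (2 * k + 2) (a + c).
  move=> /andP[k0 ke] ha; have e0 : 0 < e by vlia.
  have [p p0 vp] := val_surj v (k - i).
  have bp0 : b * p ^+ 2 != 0 by rewrite mulf_neq0 ?expf_neq0.
  have vbp : v (b * p ^+ 2) = 2 * k + 1.
    by rewrite dvalM ?expf_neq0// dvalX2// vp vb; vlia.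
  have [|y gy hy] := residue_sqrt finK two_neq0 (x := a / (b * p ^+ 2)) e0.
    by have := val_geV bp0 vbp ha; rewrite subrr.
  exists (2 * (p * y) - b * (p * y) ^+ 2); first by exists (1 + p * y), (p * y); ring.
  have -> : a + (2 * (p * y) - b * (p * y) ^+ 2) =
      b * p ^+ 2 * (a / (b * p ^+ 2) - y ^+ 2) + 2 * (p * y) by field; rewrite ?b0 ?p0.
  apply: val_geD.
    by apply: val_ge_le (val_geM (val_ge_self v _) hy); rewrite vbp; vlia.
  by apply: (val_geM_le _ (val_ge_self v 2) (val_geM (val_ge_self v p) gy)); rewrite vp; vlia.
have N0 : - b != 0 by rewrite oppr_eq0.
have vN : v (- b) = 2 * i + 1 by rewrite dvalN.
have hN : is_norm (1 + b) (- b).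
  by have := is_norm_one_sub (1 + b); congr is_norm; ring.
have ii : 0 <= e - i - 1 <= e by vlia.
have red := nonnorm_reduction ii step N0 hN vN.
have norml x : x != 0 -> ~ is_norm (1 + b) x -> exists nu z a,
    [/\ nu != 0 /\ is_norm (1 + b) nu, z != 0, ge (2 * e - 2 * i - 1) a &
    x * nu = (1 + a) * z ^+ 2 /\ ~ is_norm (1 + b) (1 + a)].
  move=> x0 nx; have [nu [n0 hn lev nn]] := red _ x0 nx.
  have xn0 : x * nu != 0 by rewrite mulf_neq0.
  have [|z [a [z0 ha E]]] := square_level_normal_succ localK two_neq0 _ xn0 lev.
    by vlia.
  exists nu, z, a; split=> //; first by apply: val_ge_le ha; vlia.
  by split=> // h; apply: nn; rewrite E; apply/is_norm_sqrl.
have [nu [z [a [[n0 hn] z0 ha [E nn]]]]] := norml _ al0 nal.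
have [nu' [z' [a' [[n0' hn'] z0' ha' [E' nn']]]]] := norml _ al'0 nal'.
apply: (norm_mul_cancel n0 n0' hn hn').
have -> : al * nu * (al' * nu') = (1 + (a + a' + a * a')) * (z * z') ^+ 2.
  by rewrite E E'; ring.
apply/is_norm_sqrl; first by rewrite mulf_neq0.
apply: is_norm_one_add => //.
have gb : ge (2 * i + 1) b by rewrite -vb; exact: val_ge_self.
have key c : ge (2 * e - 2 * i - 1) c ->
    [/\ 1 - c * b != 0, v (1 - c * b) = 0 & ge (2 * e) (1 - c * b - 1)].
  move=> hc; have h : ge (2 * e) (- (c * b)).
    by apply: val_geN; apply: (val_geM_le _ hc gb); vlia.
  have [|? ?] := @val_one_add _ v (- (c * b)); first by apply: val_ge_le h; vlia.
  by split=> //; have -> : 1 - c * b - 1 = - (c * b) by ring.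
have [d0 vd hd] := key a ha; have [d0' vd' hd'] := key a' ha'.
have [||s s0 sE] := unramified_nonsquareM finK completeK two_neq0 d0 d0' vd vd' hd hd'.
- by move=> /is_norm_one_add; auto.
- by move=> /is_norm_one_add; auto.
have haa : ge (2 * e - 2 * i - 1) (a + a' + a * a').
  by apply: val_geD (val_geD ha ha') _; apply: (val_geM_le _ ha ha'); vlia.
have [c0 vc _] := key _ haa.
apply: (is_square_near completeK two_neq0 c0 (b := s)); rewrite vc -sE.
(* The obstruction 1 - a b is multiplicative in [1 + a] up to this error, whose valuation exceeds
   [2 * e]. *)
have -> : 1 - (a + a' + a * a') * b - (1 - a * b) * (1 - a' * b) =
  - (a * a' * b * (1 + b)) by ring.
have g1b : ge 0 (1 + b).
  by apply: val_geD; [exact: val_ge1|apply: val_ge_le gb; vlia].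
apply: val_geN.
by apply: (val_geM_le _ (val_geM (val_geM ha ha') gb) g1b); vlia.
Qed.

(** For [be] in level [e] non-norms have odd valuation, so their product has even valuation and is a
    norm; any other [be] has odd valuation or a quadratic defect. *)
Lemma norm_index2 be al al' : be != 0 -> al != 0 -> al' != 0 ->
  ~ is_norm be al -> ~ is_norm be al' -> is_norm be (al * al').
Proof.
move=> be0 al0 al'0 nal nal'; have e_ge0 := val_two_ge0 v two_neq0.
have [ev|[m vbe]] := even_valP v be; last exact: norm_index2_odd vbe _ _ _ _.
have [lev|lev] := pselect (square_level v e be); last first.
  have [|z [b [i [z0 b0 E vb hi]]]] := odd_level_normal localK two_neq0 _ be0 ev lev.
    by rewrite e_ge0 lexx.
  move: nal nal'; rewrite E !is_norm_sqrr// => nal nal'.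
  exact: norm_index2_defect vb hi _ _ _ _.
have odd x : x != 0 -> ~ is_norm be x -> exists h : int, v x = 2 * h + 1.
  move=> x0 nx; have [ex|//] := even_valP v x.
  by case: nx; exact: (unit_norm_of_unramified localK).
have [h vh] := odd _ al0 nal; have [h' vh'] := odd _ al'0 nal'.
apply: (unit_norm_of_unramified localK) => //; first by rewrite mulf_neq0.
by exists (h + h' + 1); rewrite dvalM//; vlia.
Qed.

Lemma hilbertC x y : x != 0 -> y != 0 -> hilbert x y = hilbert y x.
Proof.
move=> x0 y0; rewrite !hilbert_norm//; congr (if _ then _ else _).
by apply: asbool_equiv_eq; split; exact: is_norm_sym.
Qed.

Lemma hilbertMl x x' y : x != 0 -> x' != 0 -> y != 0 ->
  hilbert (x * x') y = hilbert x y * hilbert x' y.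
Proof.
move=> x0 x'0 y0; rewrite !hilbert_norm ?mulf_neq0//.
case: asboolP => hxx'; case: asboolP => hx; case: asboolP => hx' //; exfalso.
- by apply: hx'; apply: is_norm_cancel hx _ => //; rewrite mulrC.
- by apply: hx; exact: is_norm_cancel hx' hxx'.
- by apply: hxx'; exact: is_normM.
- by apply: hxx'; exact: norm_index2.
Qed.

Lemma hilbertMr x y y' : x != 0 -> y != 0 -> y' != 0 ->
  hilbert x (y * y') = hilbert x y * hilbert x y'.
Proof.
move=> x0 y0 y'0; rewrite hilbertC ?mulf_neq0// hilbertMl//.
by rewrite !(hilbertC x0).
Qed.

Lemma hilbert1P x y : x != 0 -> y != 0 -> hilbert x y = 1 <-> is_norm y x.
Proof. by move=> x0 y0; rewrite hilbert_norm//; case: asboolP. Qed.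

Lemma hilbertN1P x y : x != 0 -> y != 0 -> hilbert x y = -1 <-> ~ is_norm y x.
Proof. by move=> x0 y0; rewrite hilbert_norm//; case: asboolP. Qed.

(** For [0 <= i < e], up to squares al = 1 + a and be = 1 + b with valuations at least [2 * i + 1]
    and [2 * (e - i)], so 1 - a b is a square. The extra one in the first bound fails at [i = e],
    which is reached by symmetry from [i = 0], or, if [e = 0], by [unit_norm_of_unramified]. *)
Lemma square_level_orthogonal i al be : al != 0 -> be != 0 ->
  square_level v i al -> square_level v (e - i) be -> is_norm be al.
Proof.
have e_ge0 := val_two_ge0 v two_neq0.
have [hi|hi] := ltP e i.
  by move=> al0 _ /(square_level_square localK two_neq0 hi al0)/(is_square_norm be).
have [hi0|hi0] := ltP i 0.
  move=> al0 be0 _ /square_level_square h; apply: is_norm_of_square => //.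
  by apply: h => //; vlia.
wlog lt : i al be hi hi0 / i < e => [h al0 be0 hal hbe|al0 be0 hal hbe].
  have [ie|ie] : i < e \/ i = e by vlia.
    exact: (h i).
  subst i; rewrite subrr in hbe; have [e0|e0] : 0 < e \/ e = 0 by vlia.
    by apply: is_norm_sym => //; apply: (h 0) => //; rewrite subr0.
  apply: (unit_norm_of_unramified localK) => //; first by rewrite {1}e0.
  by have [|] := hal; rewrite ?lexx.
have [|z [a [z0 ha ->]]] := square_level_normal_succ localK two_neq0 _ al0 hal.
  by vlia.
have [|w [u [w0 u0 vu hu ->]]] := square_level_normal _ be0 hbe; first by vlia.
apply/is_norm_sqrr => //; apply/is_norm_sqrl => //.
have -> : u = 1 + (u - 1) by ring.
apply: is_norm_one_add => //.
have hau : ge (2 * e + 1) (a * (u - 1)) by apply: (val_geM_le _ ha hu); vlia.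
have [|n0 vn] := @val_one_add _ v (- (a * (u - 1))).
  by apply: val_geN; apply: val_ge_le hau; vlia.
apply: (is_square_near completeK two_neq0 n0 (b := 1)).
have -> : 1 - a * (u - 1) - 1 ^+ 2 = - (a * (u - 1)) by ring.
by rewrite vn; apply: val_geN; apply: val_ge_le hau; vlia.
Qed.

(* By x + y = z with x = 1 + a, y = - a (1 + b), z = 1 - a b = ep, the symbol
   (1 + a, 1 + b) equals (ep, - a), where ep is unramified and v a is odd. *)
Lemma defect_nonnorm b i : b != 0 -> v b = 2 * i + 1 -> 0 <= i < e ->
  exists a, [/\ ge (2 * (e - i) - 1) a, 1 + a != 0, v (1 + a) = 0 &
    ~ is_norm (1 + b) (1 + a)].
Proof.
move=> b0 vb /andP[i0 ie].
have [ep [ep0 vep hep nep]] := exists_unramified_nonsquare finK two_neq0.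
have lep : square_level v e ep by exact: square_level_unit.
have nz1 : 1 - ep != 0.
  rewrite subr_eq0; apply/eqP => E; apply: nep; rewrite -E.
  by exists 1; rewrite ?oner_neq0 ?expr1n.
have v1 : v (1 - ep) = 2 * e.
  have : ge (2 * e) (1 - ep) by exact: val_ge_subC.
  have : ~ ge (2 * e + 1) (1 - ep).
    move=> h; apply: nep; apply: (is_square_near completeK two_neq0 ep0 (b := 1)).
    by rewrite vep expr1n; apply: val_ge_subC; apply: val_ge_le h; vlia.
  by rewrite !val_geE//; vlia.
pose a := (1 - ep) / b.
have a0 : a != 0 by rewrite mulf_neq0 ?invr_eq0.
have va : v a = 2 * (e - i) - 1 by rewrite dvalM ?invr_eq0// dvalV// v1 vb; vlia.
have ab : 1 - a * b = ep by rewrite /a; field.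
clearbody a.
have ga : ge (2 * (e - i) - 1) a by rewrite val_geE// va.
have [|n1a v1a] := @val_one_add _ v a; first by apply: val_ge_le ga; vlia.
have [|n1b v1b] := @val_one_add _ v b; first by rewrite val_geE// vb; vlia.
exists a; split=> //.
apply/hilbertN1P => //.
have Na0 : - a != 0 by rewrite oppr_eq0.
set x := 1 + a in n1a *; pose y := - a * (1 + b).
have yE : y = - a * (1 + b) by [].
have y0 : y != 0 by rewrite mulf_neq0.
(* Since x + y = ep, one has x ep = ep^2 - y ep. Expanding the symbol of (x ep, y ep) bilinearly,
   the symbols of (x, ep) and (ep, ep) are 1, and that of (ep, y) is -1 because [v y] is odd. *)
have xyz : is_norm (y * ep) (x * ep).
  by exists ep, 1; rewrite /x /y -ab; ring.
clearbody y.
have := (hilbert1P _ _).2 xyz; rewrite !mulf_neq0// => /(_ isT isT).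
rewrite hilbertMl ?mulf_neq0// !hilbertMr ?mulf_neq0//.
have -> : hilbert x y = hilbert x (1 + b).
  rewrite yE hilbertMr//; have -> : hilbert x (- a) = 1; last by rewrite mul1r.
  by apply/hilbert1P => //; exists 1, 1; rewrite /x; ring.
have unr u : u != 0 -> v u = 0 -> hilbert u ep = 1.
  move=> u0 vu; apply/hilbert1P => //; apply: (unit_norm_of_unramified localK) => //.
  by exists 0.
rewrite (unr x)// (unr ep)// mulr1 mulr1.
have -> : hilbert ep y = -1.
  rewrite hilbertC//; apply/hilbertN1P => // /(norm_of_unramified_even localK two_neq0).
  move=> /(_ ep0 y0 lep nep)[h]; rewrite yE dvalM// dvalN// va v1b; vlia.
vlia.
Qed.

(** The witness is the unramified nonsquare if [v be] is odd, a uniformizer if [be] lies in level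
    [e] (then [i < 0]), and otherwise the element that [defect_nonnorm] attaches to the quadratic
    defect of [be]. *)
Lemma square_level_nondegenerate i be : be != 0 -> ~ square_level v (e - i) be ->
  exists al, [/\ al != 0, square_level v i al & ~ is_norm be al].
Proof.
move=> be0 nbe; have e_ge0 := val_two_ge0 v two_neq0.
have ie : i <= e.
  by have [//|h] := leP i e; case: nbe => h'; vlia.
have [ep [ep0 vep hep nep]] := exists_unramified_nonsquare finK two_neq0.
have lep : square_level v e ep by exact: square_level_unit.
have [ev|[h vbe]] := even_valP v be; last first.
  exists ep; split=> //; first exact: square_level_le lep.
  move=> /is_norm_sym => /(_ two_neq0 be0 ep0).
  move=> /(norm_of_unramified_even localK two_neq0 ep0 be0 lep nep)[h'].
  by rewrite vbe; vlia.
have [lev|lev] := pselect (square_level v e be).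
  have i0 : i < 0.
    have [//|h] := ltP i 0; case: nbe; apply: square_level_le lev; vlia.
  have [p p0 vp] := val_surj v 1.
  exists p; split=> //; first by move=> h; vlia.
  have nsq : ~ is_square be.
    by move=> sq; apply: nbe; exact: (square_level_of_square localK).
  by move=> /(norm_of_unramified_even localK two_neq0 be0 p0 lev nsq)[h]; vlia.
have [j [je hj nj]] : exists j, [/\ 0 <= j <= e, j <= e - i & ~ square_level v j be].
  have [h|h] := leP 0 i; first by exists (e - i); split=> //; vlia.
  by exists e; split=> //; vlia.
have [z [b [k [z0 b0 E vb /andP[k0 kj]]]]] := odd_level_normal localK two_neq0 je be0 ev nj.
have [|a [ga n1a v1a na]] := defect_nonnorm b0 vb; first by vlia.
exists (1 + a); split=> //.
  by apply: square_level_unit => //; rewrite addrC addKr; apply: val_ge_le ga; vlia.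
by rewrite E is_norm_sqrr.
Qed.

End Duality.

(** * Counting square classes *)

Section SquareClassCount.
Variable K : fieldType.
Implicit Types (x y z : K) (al be : sqclass K).

(** Made total by sending 0 to the class of 1, so that it can serve in images of subsets of [K]. *)
Definition class_of x : sqclass K :=
  \pi_(sqclass K)%qT (insubd (Sub 1 (oner_neq0 K) : nonzero K) x).

Lemma class_of_eqP x y : x != 0 -> y != 0 ->
  class_of x = class_of y <-> is_square (x * y).
Proof.
move=> x0 y0; have E w (w0 : w != 0) :
    val (insubd (Sub 1 (oner_neq0 K) : nonzero K) w) = w by rewrite val_insubd w0.
split=> [/eqmodP/asboolP[z z0]|[z z0 zE]].
  by rewrite !E// => ->; exists (x * z); [rewrite mulf_neq0|ring].
apply/eqmodP/asboolP; exists (z / x); first by rewrite mulf_neq0 ?invr_eq0.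
by rewrite !E// expr_div_n -zE; field.
Qed.

Lemma class_reprK al : class_of (class_repr al) = al.
Proof. by rewrite /class_of /class_repr valKd reprK. Qed.

Lemma class_repr_of x : x != 0 -> exists2 z, z != 0 & class_repr (class_of x) = x * z ^+ 2.
Proof.
move=> x0; have r0 := class_repr_neq0 (class_of x).
have [z z0 E] := (class_of_eqP r0 x0).1 (class_reprK _).
exists (z / x); first by rewrite mulf_neq0 ?invr_eq0.
by rewrite expr_div_n -E; field.
Qed.

Lemma in_class_of x : x != 0 -> in_class (class_of x) x.
Proof.
move=> x0; have [z z0 E] := class_repr_of x0.
by exists z^-1; rewrite ?invr_eq0// E; field.
Qed.

End SquareClassCount.

(** * Orders of the groups in the filtration *)

Section LevelCount.
Variables (K : fieldType) (v : discrete_valuation K).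
Hypothesis localK : nonarch_local_field v.
Hypothesis two_neq0 : (2 : K) != 0.
Local Notation ge := (val_ge v).
Local Notation e := (v 2).
Local Notation q := (residue_card v).
Implicit Types (i j l m n : int) (x y z a b c d u : K) (al be : sqclass K).

Let completeK := localK.1.
Let finK := localK.2.

Lemma square_levelM i x y : x != 0 -> y != 0 ->
  square_level v i x -> square_level v i y -> square_level v i (x * y).
Proof.
move=> x0 y0 hx hy; have [i0|i0] := ltP i 0; first by move=> h; vlia.
have [z [u [z0 u0 vu hu ->]]] := square_level_normal i0 x0 hx.
have [z' [u' [z'0 u'0 vu' hu' ->]]] := square_level_normal i0 y0 hy.
have -> : u * z ^+ 2 * (u' * z' ^+ 2) = u * u' * (z * z') ^+ 2 by ring.
apply/square_level_sqr; rewrite ?mulf_neq0//.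
apply: square_level_unit; rewrite ?mulf_neq0 ?dvalM ?vu ?vu'//.
have -> : u * u' - 1 = (u - 1) * u' + (u' - 1) by ring.
apply: val_geD => //; apply: (val_geM_le _ hu (val_ge_self v u')).
by rewrite vu'; vlia.
Qed.

Lemma square_levelMr i x y : x != 0 -> y != 0 ->
  square_level v i x -> square_level v i (x * y) -> square_level v i y.
Proof.
move=> x0 y0 hx hxy; have := square_levelM x0 (mulf_neq0 x0 y0) hx hxy.
have -> : x * (x * y) = y * x ^+ 2 by ring.
by rewrite square_level_sqr.
Qed.

Definition level_classes i : set (sqclass K) :=
  [set al | square_level v i (class_repr al)].

Definition level_elts i : set K := [set x | x != 0 /\ square_level v i x].

Lemma level_classesE i : level_classes i = (@class_of K) @` level_elts i.
Proof.
apply/seteqP; split=> [al hal|_ [x [x0 hx] <-]].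
  by exists (class_repr al); rewrite ?class_reprK//; split=> //; exact: class_repr_neq0.
rewrite /level_classes /=; have [z z0 ->] := class_repr_of x0.
exact/square_level_sqr.
Qed.

Lemma card_square_classes i : e < i -> level_classes i #= `I_1.
Proof.
move=> ie; rewrite level_classesE.
suff -> : (@class_of K) @` level_elts i = [set class_of 1] by exact: card_set1.
apply/seteqP; split=> [_ [x [x0 hx] <-]|_ ->].
  apply/class_of_eqP; rewrite ?oner_neq0// mulr1.
  exact/(square_level_square localK two_neq0 ie).
exists 1 => //; split; first by rewrite oner_neq0.
apply: (square_level_of_square localK) => //.
by exists 1; rewrite ?oner_neq0 ?expr1n.
Qed.

Lemma card_unramified_classes : level_classes e #= `I_2.
Proof.
have [ep [ep0 vep hep nep]] := exists_unramified_nonsquare finK two_neq0.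
have lep : square_level v e ep by exact: square_level_unit.
have sq1 : is_square (1 : K) by exists 1; rewrite ?oner_neq0 ?expr1n.
rewrite level_classesE.
suff -> : (@class_of K) @` level_elts e = [set class_of 1] `|` [set class_of ep].
  apply: (@card_eq_setU _ _ _ 1 1); rewrite ?card_set1//.
  apply/seteqP; split=> // _ [/= -> /class_of_eqP].
  by rewrite oner_neq0 mul1r => /(_ isT ep0).
apply/seteqP; split=> [_ [x [x0 hx] <-]|_ [->|->]].
- have [sx|nx] := pselect (is_square x).
    by left; apply/class_of_eqP; rewrite ?oner_neq0// mulr1.
  by right; apply/class_of_eqP => //; exact: (unramified_index2 localK).
- exists 1 => //; split; first by rewrite oner_neq0.
  exact: (square_level_of_square localK).
- by exists ep.
Qed.

(** The elements [1 + r * p], with [r] a residue and [v p = 2 * i + 1], represent the quotient of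
    level [i] by level [i + 1]. They stay distinct because the quotient of two of them would have
    odd defect below [2 * e]. *)
Lemma card_level_classes_succ i (n : nat) : 0 <= i < e -> level_classes (i + 1) #= `I_n ->
  level_classes i #= `I_(q * n).
Proof.
move=> /andP[i0 ie] hn; have [p p0 vp] := val_surj v (2 * i + 1).
have gp : ge (2 * i + 1) p by rewrite val_geE// vp.
have unit r : ge 0 r -> [/\ 1 + r * p != 0, v (1 + r * p) = 0 & ge (2 * i + 1) (r * p)].
  move=> gr; have h : ge (2 * i + 1) (r * p) by apply: (val_geM_le _ gr gp); vlia.
  by have [|? ?] := @val_one_add _ v (r * p); first by apply: val_ge_le h; vlia.
pose F (w : K * K) := class_of ((1 + w.1 * p) * w.2).
pose G (w : K * K) := (w.1, class_of w.2).
have EF : level_classes i = F @` (residues v `*` level_elts (i + 1)).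
  rewrite level_classesE; apply/seteqP; split=> [_ [y [y0 hy] <-]|_ [[r x] [/= rr [x0 hx]] <-]].
    have [|z [a [z0 ha E]]] := square_level_normal_succ localK two_neq0 _ y0 hy.
      by vlia.
    have [|n0 vn] := @val_one_add _ v a; first by apply: val_ge_le ha; vlia.
    have gap : ge 0 (a / p) by have := val_geV p0 vp ha; rewrite subrr.
    have [gr hr] := residueP gap; set r := residue v (a / p) in gr hr.
    have [u0 vu hu] := unit r gr.
    exists (r, y / (1 + r * p)); last by rewrite /F /=; congr class_of; field.
    split; first exact: residues_residue.
    split; first by rewrite mulf_neq0 ?invr_eq0.
    rewrite E mulrAC; apply/square_level_sqr; rewrite ?mulf_neq0 ?invr_eq0//.
    apply: square_level_unit; rewrite ?mulf_neq0 ?dvalM ?invr_eq0// ?dvalV ?vu ?vn//.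
    have -> : (1 + a) / (1 + r * p) - 1 = p * (a / p - r) / (1 + r * p) by field; rewrite u0.
    by apply: val_ge_le (val_geV u0 vu (val_geM gp hr)); vlia.
  have [gr _] := residues_id rr; have [u0 vu hu] := unit r gr.
  exists ((1 + r * p) * x) => //; split; first by rewrite mulf_neq0.
  apply: square_levelM => //; last by apply: square_level_le hx; vlia.
  by apply: square_level_unit => //; rewrite addrC addKr; apply: val_ge_le hu; vlia.
have EG : residues v `*` level_classes (i + 1) = G @` (residues v `*` level_elts (i + 1)).
  rewrite level_classesE; apply/seteqP; split=> [[r _] [/= rr [x hx <-]]|_ [[r x] [/= rr hx] <-]].
    by exists (r, x).
  by split=> //; exists x.
have := card_eq_setX (card_residues finK) hn; apply: card_eq_trans; rewrite EF EG.
apply: card_image_congr => -[r x] [r' x'] [/= rr [x0 hx]] [/= rr' [x'0 hx']].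
have [gr _] := residues_id rr; have [gr' _] := residues_id rr'.
have [u0 vu hu] := unit r gr; have [u'0 vu' hu'] := unit r' gr'.
rewrite /F /G /= class_of_eqP ?mulf_neq0//.
have sqE s (s0 : 1 + s * p != 0) :
    is_square ((1 + s * p) * x * ((1 + s * p) * x')) <-> is_square (x * x').
  have -> : (1 + s * p) * x * ((1 + s * p) * x') = x * x' * (1 + s * p) ^+ 2 by ring.
  split=> h; last by apply: is_squareM => //; exact: is_square_sqr.
  have -> : x * x' = x * x' * (1 + s * p) ^+ 2 * ((1 + s * p) ^+ 2)^-1 by field.
  by apply: is_squareM => //; apply: is_squareV; exact: is_square_sqr.
split=> [h|[<- /class_of_eqP]]; last by move=> /(_ x0 x'0); rewrite sqE.
suff rE : r = r'.
  by subst r'; congr pair; apply/class_of_eqP => //; move: h; rewrite sqE.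
have hh : square_level v (i + 1) ((1 + r * p) * (1 + r' * p)).
  apply: (@square_levelMr _ (x * x')); rewrite ?mulf_neq0//; first exact: square_levelM.
  have -> : x * x' * ((1 + r * p) * (1 + r' * p)) =
    (1 + r * p) * x * ((1 + r' * p) * x') by ring.
  exact: (square_level_of_square localK).
have [||z [u [z0 un0 vun hun E]]] := square_level_normal _ _ hh; [by vlia|by rewrite mulf_neq0|].
apply: (@residues_inj _ v) => //; apply: contrapT => /not_val_ge[rr0 vrr].
have {}vrr : v (r - r') = 0.
  by have := val_geB gr gr'; rewrite val_geE//; vlia.
have vz : v z = 0.
  have := congr1 v E; rewrite dvalM// vu vu' dvalM ?expf_neq0// dvalX2// vun; vlia.
(* Thus 1 + c = (1 + r p)/(1 + r' p) = u k^2 with [k] as below; since [u] is 1 to order [2 * i + 2],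
   k^2 - 1 inherits the odd valuation of [c]. *)
pose c := (r - r') * p / (1 + r' * p).
have c0 : c != 0 by rewrite !mulf_neq0 ?invr_eq0.
have vc : v c = 2 * i + 1.
  by rewrite !dvalM ?mulf_neq0 ?invr_eq0// dvalV// vrr vp vu'; vlia.
pose k := z / (1 + r' * p).
have k0 : k != 0 by rewrite mulf_neq0 ?invr_eq0.
have vk : v k = 0 by rewrite dvalM ?invr_eq0// dvalV// vz vu'.
have kE : k ^+ 2 - 1 = c + (1 - u) * k ^+ 2.
  have -> : c = (1 + r * p) * (1 + r' * p) / (1 + r' * p) ^+ 2 - 1.
    by rewrite /c; field.
  by rewrite E /k; field.
have [|n0 vn] := @val_add_dominant _ v c ((1 - u) * k ^+ 2) c0.
  rewrite vc; apply: (val_geM_le _ (val_ge_subC hun) (val_ge_self v _)).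
  by rewrite dvalX2// vk; vlia.
rewrite -kE vc in n0 vn.
by have := val_sqr_sub1_odd two_neq0 vn n0; vlia.
Qed.

Lemma card_level_classes_sub (k : nat) : k%:Z <= e ->
  level_classes (e - k%:Z) #= `I_(2 * q ^ k).
Proof.
elim: k => [_|k IH hk]; first by rewrite subr0 expn0 muln1; exact: card_unramified_classes.
rewrite expnS mulnCA; apply: card_level_classes_succ; first by vlia.
have -> : e - k.+1%:Z + 1 = e - k%:Z by vlia.
by apply: IH; vlia.
Qed.

Lemma card_all_classes : [set: sqclass K] #= `I_(4 * q ^ `|e|).
Proof.
have e_ge0 := val_two_ge0 v two_neq0.
have h0 : level_classes 0 #= `I_(2 * q ^ `|e|).
  by have := @card_level_classes_sub `|e|%N; rewrite gez0_abs// subrr; apply.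
have [p p0 vp] := val_surj v 1.
pose P := (fun x => class_of (p * x)) @` level_elts 0.
have hP : P #= `I_(2 * q ^ `|e|).
  rewrite level_classesE in h0; apply: card_eq_trans h0.
  apply: card_image_congr => x y [x0 _] [y0 _]; rewrite !class_of_eqP ?mulf_neq0//.
  have -> : p * x * (p * y) = x * y * p ^+ 2 by ring.
  split=> h; last by apply: is_squareM => //; exact: is_square_sqr.
  have -> : x * y = x * y * p ^+ 2 * (p ^+ 2)^-1 by field.
  by apply: is_squareM => //; apply: is_squareV; exact: is_square_sqr.
have lev0 x : even_val v x -> square_level v 0 x.
  by move=> ex _; split=> //; exact: square_mod_nonpos.
have -> : [set: sqclass K] = level_classes 0 `|` P.
  apply/seteqP; split=> // al _; have a0 := class_repr_neq0 al.
  have [/lev0 ev|[h vh]] := even_valP v (class_repr al); first by left.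
  right; exists (class_repr al / p).
    split; first by rewrite mulf_neq0 ?invr_eq0.
    by apply: lev0; exists h; rewrite dvalM ?invr_eq0// dvalV// vp vh; vlia.
  by rewrite mulrC divfK// class_reprK.
have -> : (4 * q ^ `|e| = 2 * q ^ `|e| + 2 * q ^ `|e|)%N by rewrite -mulnDl.
apply: card_eq_setU => //; apply/seteqP; split=> // al [hal [x [x0 hx] E]].
have px0 : p * x != 0 by rewrite mulf_neq0.
move: hal; rewrite -E /level_classes /=; have [z z0 ->] := class_repr_of px0.
rewrite square_level_sqr// => /(_ (lexx _))[[h]].
have [//|[k vk] _] := hx; rewrite dvalM// vp vk; vlia.
Qed.

Lemma finite_sqclass : finite_set [set: sqclass K].
Proof. by apply/finite_setP; exists (4 * q ^ `|e|)%N; exact: card_all_classes. Qed.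

(** The values at [i] and [e - i] always multiply to 4q^e, the order of the whole group, as exact
    annihilators must. *)
Definition level_card i : nat :=
  if i < 0 then (4 * q ^ `|e|)%N else if i <= e then (2 * q ^ `|(e - i)%R|)%N else 1%N.

Lemma card_level_classes i : level_classes i #= `I_(level_card i).
Proof.
rewrite /level_card; have [i0|i0] := ltP i 0.
  suff -> : level_classes i = [set: sqclass K] by exact: card_all_classes.
  by apply/seteqP; split=> // al _ h; vlia.
have [ie|ie] := leP i e; last exact: card_square_classes.
have := @card_level_classes_sub `|(e - i)%R|%N; rewrite gez0_abs ?subr_ge0//.
by rewrite subKr; apply; vlia.
Qed.

End LevelCount.

(** * Counting square roots and orbits *)

Section QuotientCount.
Variables (K : fieldType) (v : discrete_valuation K).
Hypothesis finK : finite_set (int_quot v (maximal_ideal v)).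
Local Notation ge := (val_ge v).
Local Notation q := (residue_card v).
Implicit Types (m n : int) (x y z t : K).

Definition coset_mod n x : set K := [set x + y | y in val_ge v n].

(** The induction splits off the leading digit, a residue times [p] with [v p = m]. *)
Lemma card_quot (k : nat) m : coset_mod (m + k%:Z) @` val_ge v m #= `I_(q ^ k).
Proof.
elim: k m => [|k IH] m.
  rewrite addr0 expn0.
  suff -> : coset_mod m @` val_ge v m = [set coset_mod m 0] by exact: card_set1.
  apply/seteqP; split=> [_ [x hx <-]|_ ->]; last by exists 0 => //; exact: val_ge0.
  by apply/coset_eq; rewrite subr0.
have [p p0 vp] := val_surj v m; have gp : ge m p by rewrite val_geE// vp.
have -> : m + k.+1%:Z = m + 1 + k%:Z by vlia.
set n := m + 1 + k%:Z.
pose F (w : K * K) := coset_mod n (w.1 * p + w.2).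
pose G (w : K * K) := (w.1, coset_mod n w.2).
have EF : coset_mod n @` val_ge v m = F @` (residues v `*` val_ge v (m + 1)).
  apply/seteqP; split=> [_ [x hx <-]|_ [[r x] [/= rr hx] <-]].
    have gx : ge 0 (x / p) by have := val_geV p0 vp hx; rewrite subrr.
    have [gr hr] := residueP gx.
    exists (residue v (x / p), x - residue v (x / p) * p).
      split; first exact: residues_residue.
      have -> : (residue v (x / p), x - residue v (x / p) * p).2 =
        p * (x / p - residue v (x / p)) by rewrite /=; field.
      exact: val_geM.
    by rewrite /F /=; congr coset_mod; ring.
  have [gr _] := residues_id rr; exists (r * p + x) => //.
  apply: val_geD; last by apply: val_ge_le hx; vlia.
  by apply: (val_geM_le _ gr gp); vlia.
have EG : residues v `*` (coset_mod n @` val_ge v (m + 1)) =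
    G @` (residues v `*` val_ge v (m + 1)).
  apply/seteqP; split=> [[r _] [/= rr [x hx <-]]|_ [[r x] [/= rr hx] <-]].
    by exists (r, x).
  by split=> //; exists x.
have := card_eq_setX (card_residues finK) (IH (m + 1)); rewrite -expnS.
apply: card_eq_trans; rewrite EF EG.
apply: card_image_congr => -[r x] [r' x'] [/= rr hx] [/= rr' hx'].
rewrite /F /G /= coset_eq; split=> [h|[<- /coset_eq h]]; last first.
  by have -> : r * p + x - (r * p + x') = x - x' by ring.
have rE : r = r'.
  apply: (@residues_inj _ v) => //; apply/(@val_geMl _ v _ _ _ p0); rewrite vp.
  have -> : p * (r - r') = (r * p + x - (r' * p + x')) - (x - x') by ring.
  by apply: val_geB; [apply: val_ge_le h; rewrite /n; vlia|exact: val_geB].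
subst r'; congr pair; apply/coset_eq.
by have -> : x - x' = r * p + x - (r * p + x') by ring.
Qed.

Lemma card_quot_translate n m t : m <= n ->
  coset_mod n @` [set x | ge m (x - t)] #= `I_(q ^ `|(n - m)%R|).
Proof.
move=> mn; have := card_quot `|(n - m)%R| m.
have -> : m + `|(n - m)%R|%N%:Z = n by vlia.
apply: card_eq_trans.
have -> : coset_mod n @` [set x | ge m (x - t)] = (fun y => coset_mod n (y + t)) @` val_ge v m.
  apply/seteqP; split=> [_ [x hx <-]|_ [y hy <-]].
    by exists (x - t) => //; rewrite subrK.
  by exists (y + t) => //=; rewrite addrK.
apply: card_image_congr => x y hx hy; rewrite !coset_eq.
by have -> : x + t - (y + t) = x - y by ring.
Qed.

Lemma principal_idealE (s : K) : s != 0 -> principal_ideal v s = val_ge v (v s).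
Proof.
move=> s0; apply/seteqP; split=> [_ [z hz <-]|x hx].
  by rewrite -[v s]addr0; exact: val_geM (val_ge_self v s) hz.
exists (x / s); last by field.
by have := val_geV s0 erefl hx; rewrite subrr.
Qed.

Lemma ideal_norm_val (s : K) : s != 0 -> integers v s ->
  ideal_norm v s = (q ^ `|v s|)%N.
Proof.
move=> s0 ints; have vs : 0 <= v s by rewrite -(val_geE v)//.
apply: card_fset_set; rewrite /int_quot principal_idealE//.
by have := card_quot `|v s| 0; rewrite add0r gez0_abs.
Qed.

End QuotientCount.

Section SquareRoots.
Variables (K : fieldType) (v : discrete_valuation K).
Hypothesis localK : nonarch_local_field v.
Hypothesis two_neq0 : (2 : K) != 0.
Local Notation ge := (val_ge v).
Local Notation e := (v 2).
Local Notation q := (residue_card v).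
Implicit Types (m n B : int) (x y z t d : K).

Definition sqrt_mod B d : set K := [set t | ge B (t ^+ 2 - d)].

(** The roots form one ball around [t], of exponent c equal to B/2 rounded up: 2t has valuation at
    least c, so y(y + 2t) reaches valuation [B] exactly when y reaches c. As [B <= 0], the ball is a
    union of cosets of the integers. *)
Lemma card_sqrt_mod_small B d : d != 0 -> B <= 2 * e + v d -> B <= 0 ->
  square_mod v (B - v d) d ->
  coset_mod v 0 @` sqrt_mod B d #= `I_(q ^ `|(- B %/ 2)%Z|).
Proof.
move=> d0 Be B0 [t ht]; pose c := - (- B %/ 2)%Z.
have {}ht : ge B (d - t ^+ 2) by apply: val_ge_le ht; vlia.
have g2t : ge c (2 * t).
  have [h|h] := leP B (v d).
    have h' : ge B (t ^+ 2).
      have -> : t ^+ 2 = d - (d - t ^+ 2) by ring.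
      by apply: val_geB => //; apply: val_ge_self_le.
    have e0 := val_two_ge0 v two_neq0.
    by apply: (val_geM_le _ (val_ge_self v 2) (val_geX2E h')); rewrite /c; vlia.
  have [t20 vt] : t ^+ 2 != 0 /\ v (t ^+ 2) = v d.
    by apply: val_congr => //; apply: val_ge_subC; apply: val_ge_le ht; vlia.
  have t0 : t != 0 by move: t20; rewrite expf_eq0.
  rewrite dvalX2// in vt; rewrite val_geE ?mulf_neq0// dvalM// /c; vlia.
have key y : ge B (y * (y + 2 * t)) -> ge c y.
  move=> hy; apply: contrapT => /not_val_ge[y0 vy].
  have [|n0 vn] := @val_add_dominant _ v y (2 * t) y0.
    by apply: val_ge_le g2t; vlia.
  by move: hy vy; rewrite val_geE ?mulf_neq0// dvalM// vn /c; vlia.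
have -> : sqrt_mod B d = [set x | ge c (x - t)].
  apply/seteqP; split=> x /= hx.
    apply: key; have -> : (x - t) * (x - t + 2 * t) = (x ^+ 2 - d) + (d - t ^+ 2) by ring.
    exact: val_geD.
  rewrite /sqrt_mod /=.
  have -> : x ^+ 2 - d = (x - t) ^+ 2 + 2 * t * (x - t) - (d - t ^+ 2) by ring.
  apply: val_geB => //; apply: val_geD.
    by apply: val_ge_le (val_geX2 hx); rewrite /c; vlia.
  by apply: (val_geM_le _ g2t hx); rewrite /c; vlia.
have -> : `|(- B %/ 2)%Z|%N = `|(0 - c)%R|%N by rewrite /c; vlia.
by apply: (card_quot_translate localK.2); rewrite /c; vlia.
Qed.

(** Beyond the threshold the roots form two balls, around [t] and [- t], of exponent [B - e - v t];
    they are disjoint because 2t has smaller valuation than that. *)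
Lemma card_sqrt_mod_large B d t : t != 0 -> d = t ^+ 2 -> 2 * e + v d < B ->
  B - e - v t <= 0 ->
  coset_mod v 0 @` sqrt_mod B d #= `I_(2 * q ^ `|(B - e - v t)%R|).
Proof.
move=> t0 dE; rewrite dE dvalX2// => Be; set c := B - e - v t => c0.
have tt0 : 2 * t != 0 by rewrite mulf_neq0.
have vtt : v (2 * t) = e + v t by rewrite dvalM.
have g2t : ge (e + v t) (2 * t) by rewrite -vtt; exact: val_ge_self.
have key y : ge B (y * (y + 2 * t)) -> ge c y \/ ge c (y + 2 * t).
  have [-> _|y0] := eqVneq y 0; first by left; exact: val_ge0.
  have [-> _|z0] := eqVneq (y + 2 * t) 0; first by right; exact: val_ge0.
  rewrite !val_geE ?mulf_neq0// dvalM// => h.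
  have [h1|[h1|h1]] : v y < e + v t \/ v y = e + v t \/ e + v t < v y by vlia.
  - have [|_ vz] := @val_add_dominant _ v y (2 * t) y0.
      by apply: val_ge_le g2t; vlia.
    by move: h; rewrite vz; vlia.
  - by right; move: h; rewrite h1 /c; vlia.
  - have [|_] := @val_add_dominant _ v (2 * t) y tt0.
      by rewrite val_geE// vtt; vlia.
    by rewrite addrC vtt => vz; left; move: h; rewrite vz /c; vlia.
have -> : sqrt_mod B (t ^+ 2) = [set x | ge c (x - t)] `|` [set x | ge c (x - - t)].
  apply/seteqP; split=> x /=; rewrite /sqrt_mod /= opprK.
    have -> : x ^+ 2 - t ^+ 2 = (x - t) * (x - t + 2 * t) by ring.
    have -> : x + t = x - t + 2 * t by ring.
    exact: key.
  have xE : x ^+ 2 - t ^+ 2 = (x - t) * (x + t) by ring.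
  rewrite xE; case=> h.
    apply: (@val_geM_le _ _ _ c (e + v t)) => //; first by rewrite /c; vlia.
    have -> : x + t = (x - t) + 2 * t by ring.
    by apply: val_geD => //; apply: val_ge_le h; rewrite /c; vlia.
  apply: (@val_geM_le _ _ _ (e + v t) c) => //; first by rewrite /c; vlia.
  have -> : x - t = (x + t) - 2 * t by ring.
  by apply: val_geB => //; apply: val_ge_le h; rewrite /c; vlia.
have cE : (`|c| = `|(0 - c)%R|)%N by vlia.
rewrite image_setU mul2n -addnn cE.
apply: card_eq_setU; [exact: (card_quot_translate localK.2)..|].
apply/seteqP; split=> // _ [[x /= hx <-] [y /= hy /esym/coset_eq h]].
have : ge c (2 * t).
  have -> : 2 * t = (y - - t) - (y - x) - (x - t) by ring.
  by apply: val_geB => //; apply: val_geB => //; apply: val_ge_subC; apply: val_ge_le h.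
by rewrite val_geE// vtt /c; vlia.
Qed.

End SquareRoots.

(** * Cosets of the integral group in coordinates *)

Section Cosets.
Variables (K : fieldType) (v : discrete_valuation K).
Local Notation ge := (val_ge v).
Implicit Types (u w t r x : K).

Lemma gamma_mx_inj u t u' t' : gamma_mx u t = gamma_mx u' t' -> u = u' /\ t = t'.
Proof.
move=> h; split.
  by have := congr1 (fun M : 'M[K]_2 => M 0 0) h; rewrite !gamma_mxE.
by have := congr1 (fun M : 'M[K]_2 => M 0 1) h; rewrite !gamma_mxE.
Qed.

Lemma gamma_mul_mx w r u t : u != 0 -> w != 0 ->
  gamma_mul (gamma_mx w r) (gamma_mx u t) = gamma_mx (u * w) (u * r + t * w ^- 2).
Proof.
move=> u0 w0; apply/matrixP => i j; rewrite /gamma_mul !mxE !big_ord_recl big_ord0 !mxE /=.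
case: i => [[|[|//]] ?]; case: j => [[|[|//]] ?] /=; field; by rewrite ?w0 ?u0.
Qed.

Lemma integer_unitsE w : integer_units v w <-> w != 0 /\ v w = 0.
Proof.
rewrite /integer_units /integers /=; split=> [[w0]|[w0 vw]].
  by rewrite !val_geE ?invr_eq0// dvalV//; split=> //; vlia.
by split=> //; rewrite val_geE ?invr_eq0// ?dvalV// vw.
Qed.

Lemma gamma_cosetP u t m : u != 0 -> gamma_coset v (gamma_mx u t) m <->
  exists w r, [/\ w != 0, v w = 0, ge 0 r & m = gamma_mx (u * w) (u * r + t * w ^- 2)].
Proof.
move=> u0; split=> [[_ [w [r [/integer_unitsE[w0 vw] hr ->]]] <-]|[w [r [w0 vw hr ->]]]].
  by exists w, r; split=> //; rewrite gamma_mul_mx.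
exists (gamma_mx w r); last by rewrite gamma_mul_mx.
by exists w, r; split=> //; apply/integer_unitsE.
Qed.

Lemma gamma_coset_self u t : u != 0 -> gamma_coset v (gamma_mx u t) (gamma_mx u t).
Proof.
move=> u0; apply/gamma_cosetP => //; exists 1, 0; rewrite oner_neq0 dval1.
by split=> //; [exact: val_ge0|congr gamma_mx; field; rewrite ?oner_neq0].
Qed.

Lemma gamma_coset_mul u t w r : u != 0 -> w != 0 -> v w = 0 -> ge 0 r ->
  gamma_coset v (gamma_mx (u * w) (u * r + t * w ^- 2)) = gamma_coset v (gamma_mx u t).
Proof.
move=> u0 w0 vw hr; have uw0 : u * w != 0 by rewrite mulf_neq0.
have geV x n : x != 0 -> v x = 0 -> forall y, ge n y -> ge n (y * x ^- 2).
  move=> x0 vx y hy; have x20 : x ^+ 2 != 0 by rewrite expf_neq0.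
  by have := val_geV x20 (dvalX2 v x0) hy; apply: val_ge_le; vlia.
have unitV x : x != 0 -> v x = 0 -> ge 0 x^-1.
  by move=> x0 vx; rewrite val_geE ?invr_eq0// dvalV// vx.
apply/seteqP; split=> m /gamma_cosetP => /(_ _)[//|w1 [r1 [w10 vw1 hr1 ->]]];
  apply/gamma_cosetP => //.
  exists (w * w1), (w * r1 + r * w1 ^- 2); split.
  - by rewrite mulf_neq0.
  - by rewrite dvalM// vw vw1.
  - apply: val_geD; last exact: geV.
    by apply: (val_geM_le _ (val_ge_self v w) hr1); rewrite vw.
  - by congr gamma_mx; field; rewrite ?w0 ?w10.
pose w2 := w1 / w; have w20 : w2 != 0 by rewrite mulf_neq0 ?invr_eq0.
have vw2 : v w2 = 0 by rewrite dvalM ?invr_eq0// dvalV// vw vw1.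
exists w2, ((r1 - r * w2 ^- 2) / w); split=> //.
  apply: (@val_geM_le _ _ _ 0 0); [by []| |exact: unitV].
  by apply: val_geB => //; exact: geV.
rewrite /w2; congr gamma_mx; field; rewrite ?w0 ?w10//.
Qed.

(** With the off-diagonal entry written as [u * t], integral translations act by t -> t + r. *)
Lemma gamma_coset_eq u t t' : u != 0 ->
  gamma_coset v (gamma_mx u (u * t)) = gamma_coset v (gamma_mx u (u * t')) <->
  ge 0 (t - t').
Proof.
move=> u0; split=> h.
  have := gamma_coset_self (u * t) u0; rewrite h => /gamma_cosetP => /(_ u0).
  move=> [w [r [w0 vw hr /gamma_mx_inj[uE tE]]]].
  have w1 : w = 1 by apply: (mulfI u0); rewrite -uE mulr1.
  suff -> : t - t' = r by [].
  apply: (mulfI u0); rewrite mulrBr tE w1; field.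
  by rewrite ?oner_neq0.
have := gamma_coset_mul (u * t') u0 (oner_neq0 K) (dval1 v) h => <-.
by congr (gamma_coset v (gamma_mx _ _)); field; rewrite ?oner_neq0.
Qed.

Lemma gamma_coset_val u t u' t' : u != 0 -> u' != 0 ->
  gamma_coset v (gamma_mx u t) = gamma_coset v (gamma_mx u' t') -> v u = v u'.
Proof.
move=> u0 u'0 h; have := gamma_coset_self t u0; rewrite h => /gamma_cosetP => /(_ u'0).
move=> [w [r [w0 vw _ /gamma_mx_inj[-> _]]]].
by rewrite dvalM// vw addr0.
Qed.

(** A coset fixes [u] only up to units. The value of [t ^+ 2] is recorded because [root_target]
    scales by [u ^- 6]. *)
Lemma gamma_coset_normalize u u' t' : u != 0 -> u' != 0 -> v u = v u' ->
  exists t, gamma_coset v (gamma_mx u' t') = gamma_coset v (gamma_mx u (u * t)) /\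
    t ^+ 2 = t' ^+ 2 * u' ^+ 4 / u ^+ 6.
Proof.
move=> u0 u'0 vuu'; pose w := u' / u.
have w0 : w != 0 by rewrite mulf_neq0 ?invr_eq0.
have vw : v w = 0 by rewrite dvalM ?invr_eq0// dvalV// vuu' subrr.
exists (t' * w ^+ 2 / u); split; last by rewrite /w; field; rewrite ?u0.
have <- := gamma_coset_mul (u * (t' * w ^+ 2 / u)) u0 w0 vw (val_ge0 v 0).
congr (gamma_coset v (gamma_mx _ _)); first by rewrite /w; field.
by field; rewrite ?u0 ?w0.
Qed.

End Cosets.

(** * The orbit counter as a sum over the valuation of the leading coefficient *)

Section Counter.
Variables (K : fieldType) (v : discrete_valuation K).
Hypothesis localK : nonarch_local_field v.
Hypothesis two_neq0 : (2 : K) != 0.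
Local Notation ge := (val_ge v).
Local Notation e := (v 2).
Local Notation q := (residue_card v).

(* The number of cosets Gamma(O_K) g such that g f0 is integral with leading
   coefficient of valuation a, where v (I(f0)) = N and f0 has discriminant class
   D; see [card_orbit_piece]. *)
Definition orbit_weight (N : int) (a : nat) (D : K) : nat :=
  if `[< (2 %| a%:Z - N + v D)%Z /\ square_mod v (2 * a%:Z - N + 2 * e) D >] then
    if 2 * a%:Z <= N then (q ^ (a %/ 2))%N else (2 * q ^ `|((N - a%:Z) %/ 2)%Z|)%N
  else 0%N.

Variables (s J D : K).
Hypotheses (s_neq0 : s != 0) (J_neq0 : J != 0) (D_neq0 : D != 0).
Hypothesis vs : 0 <= v s <= e.
Implicit Types (i j l m n : int) (x y z t u : K).

Let f0 := BQF (J / D) 0 (- (D ^+ 2 / (4 * J))).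
Let four0 := four_neq0 two_neq0.

(** The form [f0] moved by [u] has leading coefficient a = (J/D)u^2 and discriminant D/u^2;
    completing the square gives c = a(t^2 - δ) with δ = (D/u^2)/(4a^2), which is this value. *)
Definition root_target u : K := D ^+ 3 / (4 * J ^+ 2 * u ^+ 6).

Lemma root_target_neq0 u : u != 0 -> root_target u != 0.
Proof. by move=> u0; rewrite !(mulf_neq0, invr_eq0, expf_neq0). Qed.

Lemma val_root_target u : u != 0 -> v (root_target u) = 3 * v D - 2 * e - 2 * v J - 6 * v u.
Proof.
move=> u0; pose X := D / (2 * J * u ^+ 2 * u).
have n1 : 2 * J != 0 by rewrite mulf_neq0.
have n2 : u ^+ 2 != 0 by rewrite expf_neq0.
have n3 : 2 * J * u ^+ 2 != 0 by rewrite mulf_neq0.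
have n4 : 2 * J * u ^+ 2 * u != 0 by rewrite mulf_neq0.
have n5 : (2 * J * u ^+ 2 * u)^-1 != 0 by rewrite invr_eq0.
have X0 : X != 0 by rewrite mulf_neq0.
have vX : v X = v D - e - v J - 3 * v u.
  rewrite (dvalM v D_neq0 n5) (dvalV v n4) (dvalM v n3 u0) (dvalM v n1 n2).
  by rewrite (dvalX2 v u0) (dvalM v two_neq0 J_neq0); vlia.
have -> : root_target u = D * X ^+ 2.
  by rewrite /root_target /X; field; rewrite J_neq0 u0 two_neq0 four0.
rewrite (dvalM v D_neq0 (expf_neq0 2 X0)) (dvalX2 v X0) vX.
vlia.
Qed.

(** Once c is integral, the condition on b depends on [a] alone: t^2 equals [root_target u], of
    valuation v(J) - 3a - 2e, up to an error of valuation at least -a, which is harmless because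
    [v s <= e]. *)
Lemma Vint_act u t : u != 0 ->
  Vint v s J (bqf_act (gamma_mx u (u * t)) f0) <->
  [/\ 0 <= v J - v D + 2 * v u, v J - v D + 2 * v u <= v J - 2 * v s &
    sqrt_mod v (- (v J - v D + 2 * v u)) (root_target u) t].
Proof.
move=> u0; set a := v J - v D + 2 * v u.
have u20 : u ^+ 2 != 0 by rewrite expf_neq0.
have V0 : D^-1 != 0 by rewrite invr_eq0.
have JD0 : J / D != 0 by rewrite mulf_neq0.
have c0 : J / D * u ^+ 2 != 0 by rewrite mulf_neq0.
have vc : v (J / D * u ^+ 2) = a.
  by rewrite (dvalM v JD0 u20) (dvalM v J_neq0 V0) (dvalV v D_neq0) (dvalX2 v u0).
have GK : GammaK (gamma_mx u (u * t)) by exists u, (u * t).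
have I0 : bqf_I f0 = J.
  by rewrite /bqf_I /bqf_disc /=; field; rewrite D_neq0 J_neq0 four0.
have qaE : qa (bqf_act (gamma_mx u (u * t)) f0) = J / D * u ^+ 2.
  by rewrite /= !gamma_mxE; ring.
have qbE : qb (bqf_act (gamma_mx u (u * t)) f0) = J / D * u ^+ 2 * (2 * t).
  by rewrite /= !gamma_mxE; ring.
have qcE : qc (bqf_act (gamma_mx u (u * t)) f0) =
    J / D * u ^+ 2 * (t ^+ 2 - root_target u).
  rewrite /= !gamma_mxE /root_target; field.
  by rewrite u0 D_neq0 J_neq0 four0.
have IE : bqf_I (bqf_act (gamma_mx u (u * t)) f0) = J by rewrite bqf_I_act// I0.
move: qaE qbE qcE IE; move: (bqf_act _ _) => g qaE qbE qcE IE.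
rewrite /Vint /= IE qaE qbE qcE principal_idealE// /integers.
have -> : ge 0 (J / D * u ^+ 2) = (0 <= a) :> Prop by rewrite val_geE// vc.
have gecE n x : ge n (J / D * u ^+ 2 * x) = ge (n - a) x.
  by apply/propext; rewrite -(val_geMl v _ x c0) vc subrKC.
rewrite !gecE sub0r.
have ge2E n : ge n (2 * t) = ge (n - e) t.
  by apply/propext; rewrite -(val_geMl v _ t two_neq0) subrKC.
rewrite ge2E /sqrt_mod /=.
have d0 := root_target_neq0 u0; have vd := val_root_target u0.
have vd' : v (root_target u) = v J - 3 * a - 2 * e by rewrite vd /a; vlia.
split=> [[a0 hb hc _]|[a0 an hc]]; split=> //.
- have : ge (2 * (v s - a - e)) (root_target u).
    have -> : root_target u = t ^+ 2 - (t ^+ 2 - root_target u) by ring.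
    by apply: val_geB; [exact: val_geX2|apply: val_ge_le hc; vlia].
  by rewrite val_geE// vd'; vlia.
- have /val_geX2E : ge (2 * (v s - a - e)) (t ^+ 2).
    have -> : t ^+ 2 = (t ^+ 2 - root_target u) + root_target u by ring.
    apply: val_geD; first by apply: val_ge_le hc; vlia.
    by rewrite val_geE// vd'; vlia.
  by apply: val_ge_le; vlia.
Qed.

Lemma square_mod_root_target u n : u != 0 ->
  square_mod v n (root_target u) <-> square_mod v n D.
Proof.
move=> u0; have -> : root_target u = D * (D / (2 * J * u ^+ 3)) ^+ 2.
  by rewrite /root_target; field; rewrite ?J_neq0 ?u0 ?two_neq0 ?four0.
apply: square_mod_sqr => //.
by rewrite mulf_neq0 ?invr_eq0// !mulf_neq0 ?expf_neq0.
Qed.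

Let piece (a : nat) : set (set 'M[K]_2) :=
  [set C | exists u t, [/\ u != 0, 2 * v u = a%:Z - v J + v D,
    sqrt_mod v (- a%:Z) (root_target u) t & C = gamma_coset v (gamma_mx u (u * t))]].

(** For a fixed [u] the cosets are square roots modulo the integers at precision B = -a, and the
    test 2a <= v(J) in [orbit_weight] separates the one-ball count from the two-ball count. *)
Lemma card_orbit_piece (a : nat) : a%:Z <= v J - 2 * v s ->
  piece a #= `I_(orbit_weight (v J) a D).
Proof.
move=> an; rewrite /orbit_weight.
have [/dvdzP[w hw]|odd] := boolP (2 %| a%:Z - v J + v D)%Z; last first.
  case: asboolP => [[]//|_].
  suff -> : piece a = set0 by rewrite II0 card_eq00.
  apply/seteqP; split=> // C [u [t [_ h _ _]]]; case/negP: odd.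
  by apply/dvdzP; exists (v u); vlia.
have [u u0 vu] := val_surj v w; have d0 := root_target_neq0 u0.
have vd : v (root_target u) = v J - 3 * a%:Z - 2 * e.
  by rewrite val_root_target// vu; vlia.
have eqP2 : forall P : Prop, (true /\ P) = P by move=> P; apply/propext; split=> [[]|].
have pE : piece a = (fun t => gamma_coset v (gamma_mx u (u * t))) @`
    sqrt_mod v (- a%:Z) (root_target u).
  apply/seteqP; split=> [C [u' [t' [u'0 vu' ht' ->]]]|_ [t ht <-]]; last first.
    by exists u, t; split=> //; vlia.
  have [|t [-> tE]] := @gamma_coset_normalize _ v _ _ (u' * t') u0 u'0; first by vlia.
  exists t => //; rewrite /sqrt_mod /= tE.
  have -> : (u' * t') ^+ 2 * u' ^+ 4 / u ^+ 6 - root_target u =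
      (t' ^+ 2 - root_target u') * (u' / u) ^+ 6.
    by rewrite /root_target; field; rewrite ?J_neq0 ?u0 ?u'0 ?four0.
  have w0 : u' / u != 0 by rewrite mulf_neq0 ?invr_eq0.
  have vw : v (u' / u) = 0 by rewrite dvalM ?invr_eq0// dvalV//; vlia.
  have g1 : ge 0 (u' / u) by rewrite val_geE// vw.
  have g2 := val_geX2 g1.
  have -> : (u' / u) ^+ 6 = (u' / u) ^+ 2 * ((u' / u) ^+ 2 * (u' / u) ^+ 2) by ring.
  by apply: (val_geM_le _ ht' (val_geM g2 (val_geM g2 g2))); vlia.
have cE : piece a #= coset_mod v 0 @` sqrt_mod v (- a%:Z) (root_target u).
  by rewrite pE; apply: card_image_congr => t t' _ _; rewrite gamma_coset_eq// coset_eq.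
apply: card_eq_trans cE _; rewrite eqP2.
rewrite (asbool_equiv_eq (iff_sym (square_mod_root_target _ u0))).
have rE : 2 * a%:Z - v J + 2 * e = - a%:Z - v (root_target u) by rewrite vd; vlia.
rewrite rE; case: asboolP => [sq|nsq]; last first.
  suff -> : sqrt_mod v (- a%:Z) (root_target u) = set0 by rewrite image_set0 II0 card_eq00.
  apply/seteqP; split=> // t ht; apply: nsq; exists t.
  by apply: val_ge_subC; rewrite subrKC.
have [h|h] := leP (2 * a%:Z) (v J).
  have -> : (a %/ 2 = `|(- - a%:Z %/ 2)%Z|)%N by vlia.
  by apply: (card_sqrt_mod_small localK two_neq0) => //; rewrite ?vd; vlia.
have [|t t0 tE] := (square_mod_square localK two_neq0 _ d0).1 sq; first by rewrite vd; vlia.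
have vt : 2 * v t = v J - 3 * a%:Z - 2 * e by rewrite -vd tE dvalX2.
have -> : `|((v J - a%:Z) %/ 2)%Z|%N = `|(- a%:Z - e - v t)%R|%N by vlia.
by apply: (card_sqrt_mod_large localK two_neq0 t0 tE); rewrite ?vd; vlia.
Qed.

(** [M] counts the admissible valuations; phrased as an equivalence, the hypothesis also covers an
    empty range with [M = 0]. *)
Lemma coset_count_weights (M : nat) :
  (forall k : int, 0 <= k -> (k <= v J - 2 * v s) = (k < M%:Z)) ->
  coset_count v s J f0 = (\sum_(a < M) orbit_weight (v J) a D)%N.
Proof.
move=> hM; apply: card_fset_set.
have -> : integral_cosets v s J f0 = \bigcup_(a < M) piece a.
  apply/seteqP; split=> [_ [g [[u [t [u0 ->]]] Vg] <-]|_ [a /= aM [u [t [u0 vu ht ->]]]]].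
    have tE : t = u * (t / u) by field.
    rewrite tE in Vg *; move: Vg => /(Vint_act _ u0)[a0 an ht].
    exists `|(v J - v D + 2 * v u)%R|%N.
      by rewrite /= -ltz_nat gez0_abs// -hM.
    exists u, (t / u); split=> //; rewrite gez0_abs//.
    by vlia.
  exists (gamma_mx u (u * t)) => //; split; first by exists u, (u * t).
  have aE : v J - v D + 2 * v u = a%:Z by vlia.
  apply/Vint_act => //; rewrite aE; split=> //.
  by rewrite hM// ltz_nat.
apply: (card_eq_bigcup (c := fun a => orbit_weight (v J) a D)) => [a aM|a b _ _].
  by apply: card_orbit_piece; rewrite hM// ltz_nat.
move=> [_ [[u [t [u0 vu _ ->]]] [u' [t' [u'0 vu' _ /gamma_coset_val]]]]].
by move=> /(_ u0 u'0); vlia.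
Qed.

End Counter.

Section OrbitCounterFormula.
Variables (K : fieldType) (v : discrete_valuation K).
Hypothesis localK : nonarch_local_field v.
Hypothesis two_neq0 : (2 : K) != 0.

Lemma orbit_counter_weights (s J : K) (al : sqclass K) (M : nat) :
  s != 0 -> J != 0 -> 0 <= v s <= v 2 ->
  (forall k : int, 0 <= k -> (k <= v J - 2 * v s) = (k < M%:Z)) ->
  orbit_counter v s J al = (\sum_(a < M) orbit_weight v (v J) a (class_repr al))%N.
Proof.
move=> s0 J0 vs hM; have D0 := class_repr_neq0 al.
rewrite -(coset_count_weights localK two_neq0 s0 J0 D0 vs hM).
have f4 := four_neq0 two_neq0.
apply: orbit_counterE => //; rewrite /bqf_I /bqf_disc /=.
  by field; rewrite ?D0 ?J0 ?f4.
by exists 1; rewrite ?oner_neq0//; field; rewrite ?D0 ?J0 ?f4.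
Qed.

End OrbitCounterFormula.

(** * The Fourier transform *)

Section WeightPairs.
Variables (K : fieldType) (v : discrete_valuation K).
Local Notation e := (v 2).
Local Notation q := (residue_card v).
Implicit Types (i : int) (D : K).

Definition level_ind i D : nat := `[< square_level v i D >].

Lemma level_ind_neg i D : i < 0 -> level_ind i D = 1%N.
Proof. by move=> i0; rewrite /level_ind asboolT// => h; vlia. Qed.

Lemma orbit_weightE (N : int) (a : nat) D :
  orbit_weight v N a D =
    (`[< (2 %| (a%:Z - N + v D)%R)%Z /\ square_mod v (2 * a%:Z - N + 2 * e)%R D >] *
     (if (2 * a%:Z <= N)%R then q ^ (a %/ 2) else 2 * q ^ `|((N - a%:Z)%R %/ 2)%Z|))%N.
Proof. by rewrite /orbit_weight; case: asboolP => _; rewrite ?mul1n ?mul0n. Qed.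

Lemma even_val_dvd D : even_val v D <-> (2 %| v D)%Z.
Proof.
split=> [[h hD]|/dvdzP[h hD]]; first by apply/dvdzP; exists h; vlia.
by exists h; vlia.
Qed.

Lemma level_ind0 D : level_ind 0 D = (2 %| v D)%Z.
Proof.
rewrite /level_ind; congr nat_of_bool.
apply/asboolP/idP => [/(_ (lexx _))[/even_val_dvd//]|/even_val_dvd ev _].
by split=> //; exact: square_mod_nonpos.
Qed.

Lemma square_mod_odd n D : D != 0 -> ~~ (2 %| v D)%Z ->
  square_mod v n D <-> n <= 0.
Proof.
move=> D0 odd; split=> [h|]; last exact: square_mod_nonpos.
have [//|n0] := leP n 0; case/negP: odd; apply/even_val_dvd.
exact: square_mod_even h.
Qed.

Lemma sum_pairs (M : nat) (f : nat -> nat) :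
  (\sum_(a < M.+1.*2) f a = \sum_(mu < M.+1) (f mu.*2 + f mu.*2.+1))%N.
Proof.
elim: M => [|M IH]; first by rewrite !big_ord_recr !big_ord0 /= add0n.
by rewrite doubleS 2!big_ord_recr /= IH [RHS]big_ord_recr /= addnA.
Qed.

Hypothesis localK : nonarch_local_field v.
Hypothesis two_neq0 : (2 : K) != 0.
Variables (t s : nat).
Hypothesis ets : e = t%:Z + s%:Z.

(** The parity of [v D] decides which term is live. The first has precision [2 * i]; the second has
    [2 * i + 2] and admits odd valuations only for [i < 0], where it completes the pair to the whole
    group. *)
Lemma weight_pair_even (M mu h : nat) D : D != 0 -> (mu + h = M)%N ->
  let i := s%:Z + mu%:Z - h%:Z in
  (orbit_weight v (M.*2 + t.*2)%:Z mu.*2 D + orbit_weight v (M.*2 + t.*2)%:Z mu.*2.+1 D =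
   (if (e < i)%R then 2 * q ^ (t + h) else q ^ mu) * level_ind i D)%N.
Proof.
move=> D0 hM i; rewrite !orbit_weightE.
have -> : (mu.*2 %/ 2 = mu)%N by vlia.
have -> : (mu.*2.+1 %/ 2 = mu)%N by vlia.
have -> : `|(((M.*2 + t.*2)%:Z - mu.*2%:Z)%R %/ 2)%Z|%N = (t + h)%N by vlia.
have -> : 2 * mu.*2%:Z - (M.*2 + t.*2)%:Z + 2 * e = 2 * i by rewrite /i; vlia.
have -> : 2 * mu.*2.+1%:Z - (M.*2 + t.*2)%:Z + 2 * e = 2 * i + 2 by rewrite /i; vlia.
have -> : (2 * mu.*2%:Z <= (M.*2 + t.*2)%:Z) = ~~ (e < i) by rewrite /i; vlia.
have -> : (2 * mu.*2.+1%:Z <= (M.*2 + t.*2)%:Z) = (i < e) by rewrite /i; vlia.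
have -> : (2 %| mu.*2%:Z - (M.*2 + t.*2)%:Z + v D)%Z = (2 %| v D)%Z by vlia.
have -> : (2 %| mu.*2.+1%:Z - (M.*2 + t.*2)%:Z + v D)%Z = ~~ (2 %| v D)%Z by vlia.
have e0 := val_two_ge0 v two_neq0.
have [ev|od] /= := boolP (2 %| v D)%Z.
  rewrite [X in (_ + nat_of_bool X * _)%N]asboolF ?mul0n ?addn0; last by case.
  rewrite if_neg mulnC /level_ind; congr (_ * nat_of_bool _)%N.
  apply: asbool_equiv_eq; rewrite /square_level even_val_dvd ev.
  split=> [[_ h'] _ //|]; have [i0|i0] := ltP i 0; last by apply.
  by move=> _; split=> //; apply: square_mod_nonpos; vlia.
rewrite [X in (nat_of_bool X * _ + _)%N]asboolF ?mul0n ?add0n; last by case.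
have [i0|i0] := ltP i 0.
  rewrite asboolT; last by split=> //; apply: square_mod_nonpos; vlia.
  rewrite mul1n level_ind_neg// muln1.
  have -> : (i < e) = true by vlia.
  by have -> : (e < i) = false by vlia.
rewrite asboolF; last by move=> [_ /(square_mod_odd _ D0 od)]; vlia.
rewrite mul0n /level_ind asboolF ?muln0// => /(_ i0)[/even_val_dvd].
by rewrite (negbTE od).
Qed.

(** Now the first term sees odd valuations at precision [2 * i - 1], the second even ones at
    precision [2 * i + 1]. For 0 <= i < e the latter is level [i] by [square_mod_succ]; from i = e
    on it means being a square, that is level [e + 1]. *)
Lemma weight_pair_odd (M mu h : nat) D : D != 0 -> (mu + h = M)%N ->
  let i := s%:Z + mu%:Z - h%:Z in
  (orbit_weight v (M.*2.+1 + t.*2)%:Z mu.*2 D +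
   orbit_weight v (M.*2.+1 + t.*2)%:Z mu.*2.+1 D =
   (i <= 0)%R * q ^ mu * ~~ (2 %| v D)%Z +
   (if (e <= i)%R then 2 * q ^ (t + h) * level_ind (e + 1)%R D
    else q ^ mu * level_ind (Num.max 0%R i) D))%N.
Proof.
move=> D0 hM i; rewrite !orbit_weightE.
have -> : (mu.*2 %/ 2 = mu)%N by vlia.
have -> : (mu.*2.+1 %/ 2 = mu)%N by vlia.
have -> : `|(((M.*2.+1 + t.*2)%:Z - mu.*2.+1%:Z) %/ 2)%Z|%N = (t + h)%N by vlia.
have -> : 2 * mu.*2%:Z - (M.*2.+1 + t.*2)%:Z + 2 * e = 2 * i - 1 by rewrite /i; vlia.
have -> : 2 * mu.*2.+1%:Z - (M.*2.+1 + t.*2)%:Z + 2 * e = 2 * i + 1 by rewrite /i; vlia.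
have -> : (2 * mu.*2%:Z <= (M.*2.+1 + t.*2)%:Z) = (i <= e) by rewrite /i; vlia.
have -> : (2 * mu.*2.+1%:Z <= (M.*2.+1 + t.*2)%:Z) = ~~ (e <= i) by rewrite /i; vlia.
have -> : (2 %| mu.*2%:Z - (M.*2.+1 + t.*2)%:Z + v D)%Z = ~~ (2 %| v D)%Z by vlia.
have -> : (2 %| mu.*2.+1%:Z - (M.*2.+1 + t.*2)%:Z + v D)%Z = (2 %| v D)%Z by vlia.
have e0 := val_two_ge0 v two_neq0.
have [ev|od] /= := boolP (2 %| v D)%Z; last first.
  rewrite [X in (_ + nat_of_bool X * _)%N]asboolF ?mul0n ?addn0; last by case.
  have lev0 j : 0 <= j -> level_ind j D = 0%N.
    by move=> j0; rewrite /level_ind asboolF// => /(_ j0)[/even_val_dvd]; rewrite (negbTE od).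
  rewrite !lev0 ?le_max ?lexx//; last by vlia.
  rewrite !muln0 if_same addn0 muln1.
  have [i0|i0] := leP i 0.
    rewrite asboolT; last by split=> //; apply: square_mod_nonpos; vlia.
    by have -> : (i <= e) = true by vlia.
  by rewrite asboolF// => -[_ /(square_mod_odd _ D0 od)]; vlia.
rewrite [X in (nat_of_bool X * _ + _)%N]asboolF ?mul0n ?add0n; last by case.
rewrite muln0 add0n if_neg; have [ei|ie] := leP e i.
  rewrite mulnC; congr (_ * nat_of_bool _)%N; apply: asbool_equiv_eq.
  rewrite square_level_square//; last by vlia.
  rewrite -(square_mod_square localK two_neq0 (r := 2 * i + 1))//; last by vlia.
  by split=> [[]|].
rewrite mulnC; congr (_ * nat_of_bool _)%N; apply: asbool_equiv_eq.
have [i0|i0] := ltP i 0.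
  split=> [_ _|_]; last by split=> //; apply: square_mod_nonpos; vlia.
  by split; [exact/even_val_dvd|apply: square_mod_nonpos; vlia].
split=> [[_ h'] _|h'].
  by split; [exact/even_val_dvd|apply: square_mod_le h'; vlia].
by split=> //; apply: (square_mod_succ localK) => //; vlia.
Qed.

(** For even [n] the range 0, ..., n leaves its last pair incomplete; the missing term is zero and
    may be added. *)
Lemma orbit_weight_last (n : nat) D : D != 0 -> ~~ odd n ->
  orbit_weight v (n + t.*2)%:Z n.+1 D = 0%N.
Proof.
move=> D0 evn; rewrite orbit_weightE asboolF ?mul0n// => -[par sq].
have od : ~~ (2 %| v D)%Z by vlia.
by have := (square_mod_odd _ D0 od).1 sq; vlia.
Qed.

Lemma sum_weights (n : nat) D : D != 0 ->
  (\sum_(a < n.+1) orbit_weight v (n + t.*2)%:Z a D =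
   \sum_(mu < n./2.+1) (orbit_weight v (n + t.*2)%:Z mu.*2 D +
                        orbit_weight v (n + t.*2)%:Z mu.*2.+1 D))%N.
Proof.
move=> D0; rewrite -(sum_pairs _ (fun a => orbit_weight v (n + t.*2)%:Z a D)).
have := odd_double_half n; have := @orbit_weight_last n D D0.
case: (odd n) => /= last nE.
  by have -> : n./2.+1.*2 = n.+1 by vlia.
have -> : n./2.+1.*2 = n.+2 by vlia.
by rewrite [RHS]big_ord_recr /= last// addn0.
Qed.

End WeightPairs.

Section Fourier.
Variables (K : fieldType) (v : discrete_valuation K).
Hypothesis localK : nonarch_local_field v.
Hypothesis two_neq0 : (2 : K) != 0.
Local Notation e := (v 2).
Local Notation q := (residue_card v).
Variable C : numFieldType.
Implicit Types (i : int) (al be : sqclass K).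

(** Twice [fourier], for functions with natural values. *)
Definition char_sum (g : sqclass K -> nat) be : C :=
  \sum_(al \in [set: sqclass K]) ((g al)%:R * (hilbert_class al be)%:~R : C).

Lemma char_sumE g be : char_sum g be =
  \sum_(al <- fset_set [set: sqclass K]) ((g al)%:R * (hilbert_class al be)%:~R : C).
Proof. by rewrite /char_sum fsbig_finite//; exact: finite_sqclass localK two_neq0. Qed.

Lemma char_sumD g g' be :
  char_sum (fun al => g al + g' al)%N be = char_sum g be + char_sum g' be.
Proof.
rewrite !char_sumE -big_split /=; apply: eq_bigr => al _.
by rewrite natrD mulrDl.
Qed.

Lemma char_sumZ k g be : char_sum (fun al => k * g al)%N be = k%:R * char_sum g be.
Proof.
rewrite !char_sumE mulr_sumr; apply: eq_bigr => al _.
by rewrite natrM mulrA.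
Qed.

Lemma char_sum_sum (n : nat) (g : nat -> sqclass K -> nat) be :
  char_sum (fun al => \sum_(a < n) g a al)%N be = \sum_(a < n) char_sum (g a) be.
Proof.
rewrite char_sumE; under eq_bigr do rewrite natr_sum mulr_suml.
by rewrite exchange_big /=; apply: eq_bigr => a _; rewrite char_sumE.
Qed.

Lemma eq_char_sum g g' be : g =1 g' -> char_sum g be = char_sum g' be.
Proof. by move=> gg'; congr char_sum; apply/funext. Qed.

(** Orthogonality: the symbol with [be] is trivial on level [i], or else translating by some [a0] of
    symbol -1 yields [S = - S]. *)
Lemma char_sum_level i be :
  char_sum (fun al => level_ind v i (class_repr al)) be =
  (level_card v i * level_ind v (e - i) (class_repr be))%:R.
Proof.
have be0 := class_repr_neq0 be; pose A := level_classes v i.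
have cA := card_level_classes localK two_neq0 i.
have finA : finite_set A by apply/finite_setP; exists (level_card v i).
have -> : char_sum (fun al => level_ind v i (class_repr al)) be =
    \sum_(al \in A) ((hilbert_class al be)%:~R : C).
  rewrite [RHS]fsbig_mkcond /char_sum; apply: eq_fsbigr => al _.
  rewrite /patch /level_ind; case: asboolP => h.
    by rewrite mem_set// mul1r.
  by rewrite memNset// mul0r.
rewrite /level_ind; case: asboolP => hbe.
  rewrite muln1 -(card_fset_set cA) fsbig_finite// -/A.
  rewrite card_fset_sum1 natr_sum; apply: eq_big_seq => al.
  rewrite in_fset_set// inE => hal.
  suff -> : hilbert_class al be = 1 by [].
  have al0 := class_repr_neq0 al.
  apply/hilbert1P => //; exact: square_level_orthogonal hal hbe.
rewrite muln0; have [a0 [a00 ha0 na0]] := square_level_nondegenerate localK two_neq0 be0 hbe.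
pose f al := class_of (a0 * class_repr al).
have fM x : x != 0 -> f (class_of x) = class_of (a0 * x).
  move=> x0; rewrite /f; have [z z0 ->] := class_repr_of x0.
  apply/class_of_eqP; rewrite ?mulf_neq0 ?expf_neq0//.
  by exists (a0 * x * z); [rewrite !mulf_neq0|ring].
have ff al : f (f al) = al.
  have al0 := class_repr_neq0 al.
  rewrite {2}/f fM ?mulf_neq0// -[RHS]class_reprK; apply/class_of_eqP; rewrite ?mulf_neq0//.
  by exists (a0 * class_repr al); [rewrite mulf_neq0|ring].
have fA al : A al -> A (f al).
  rewrite /A /level_classes /= => hal; have al0 := class_repr_neq0 al.
  have m0 : a0 * class_repr al != 0 by rewrite mulf_neq0.
  rewrite /f; have [z z0 ->] := class_repr_of m0.
  by apply/square_level_sqr => //; exact: square_levelM.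
have bij : set_bij A A f.
  split=> [al /fA//|al be' _ _ E|al hal]; first by rewrite -(ff al) E ff.
  by exists (f al); [exact: fA|exact: ff].
set S := \sum_(al \in A) _.
have SN : S = - S.
  rewrite {1}/S (reindex_fsbig f A A)// /S.
  rewrite !fsbig_finite//= -sumrN; apply: eq_bigr => al _.
  rewrite -mulrNz; congr (_%:~R); have al0 := class_repr_neq0 al.
  have m0 : a0 * class_repr al != 0 by rewrite mulf_neq0.
  rewrite (hilbert_classE (in_class_of m0) (b := class_repr be)); last first.
    by exists 1; rewrite ?oner_neq0// expr1n mulr1.
  by rewrite (hilbertMl localK)// ((hilbertN1P two_neq0 a00 be0).2 na0) mulN1r.
have : S + S = 0 by rewrite {2}SN subrr.
by rewrite -mulr2n => /eqP; rewrite mulrn_eq0 /= => /eqP.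
Qed.

Variables (t s : nat).
Hypothesis ets : e = t%:Z + s%:Z.

Let setss : e = s%:Z + t%:Z. Proof. by rewrite ets addrC. Qed.

Let wpair (d n mu : nat) (al : sqclass K) : nat :=
  (orbit_weight v (n + d.*2)%:Z mu.*2 (class_repr al) +
   orbit_weight v (n + d.*2)%:Z mu.*2.+1 (class_repr al))%N.

(** Exchanging [t] with [s] and [mu] with [h] turns level i into e - i; in each of the ranges i < 0,
    0 <= i <= e and e < i, [level_card] times the weight at [mu] is 2q^t times the weight at [h]. *)
Lemma char_sum_pair_even (M mu h : nat) be : (mu + h = M)%N ->
  char_sum (wpair t M.*2 mu) be = 2 * (q ^ t * wpair s M.*2 h be)%:R.
Proof.
move=> hM; have e0 := val_two_ge0 v two_neq0.
under eq_char_sum => al do rewrite /wpair (weight_pair_even two_neq0 ets (class_repr_neq0 al) hM).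
rewrite char_sumZ char_sum_level /wpair.
rewrite (weight_pair_even two_neq0 setss (class_repr_neq0 be) (_ : (h + mu = M)%N)); last first.
  by rewrite addnC.
rewrite -!natrM; congr (_%:R).
set i := s%:Z + mu%:Z - h%:Z.
have -> : t%:Z + h%:Z - mu%:Z = e - i by rewrite ets /i; vlia.
rewrite !mulnA; congr (_ * _)%N; rewrite /level_card.
have [ei|ie] := ltP e i.
  have -> : (i < 0) = false by vlia.
  have -> : (e < e - i) = false by vlia.
  by rewrite muln1 expnD mulnA.
have [i0|i0] := ltP i 0.
  have -> : (e < e - i) = true by vlia.
  have -> : `|e|%N = (t + s)%N by vlia.
  by rewrite !expnD; ring.
have -> : (e < e - i) = false by vlia.
have E : (mu + `|(e - i)%R| = t + h)%N by rewrite /i; vlia.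
by rewrite mulnCA -expnD E expnD; ring.
Qed.

(** When i <= 0 and i < e, odd valuations join level 0 to give everything, encoded as level -1. At i
    = e = 0 odd classes and squares are live together with different weights, which the third
    hypothesis excludes. *)
Lemma wpair_odd (d d' M mu h : nat) al : e = d%:Z + d'%:Z -> (mu + h = M)%N ->
  (0 < e \/ mu <> h) ->
  let i := d'%:Z + mu%:Z - h%:Z in
  wpair d M.*2.+1 mu al =
  ((if (e <= i)%R then 2 * q ^ (d + h) else q ^ mu) *
   level_ind v (if (e <= i)%R then e + 1 else if (i <= 0)%R then -1 else i)%R
     (class_repr al))%N.
Proof.
move=> ed hM gen i; have e0 := val_two_ge0 v two_neq0; have D0 := class_repr_neq0 al.
rewrite /wpair (weight_pair_odd localK two_neq0 ed D0 hM) -/i.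
have [ei|ie] := leP e i.
  by have -> : (i <= 0) = false by rewrite /i in ei *; vlia.
have [i0|i0] := leP i 0; last by rewrite mul0n add0n.
rewrite mul1n (@level_ind_neg _ v (-1))// -mulnDr; congr (_ * _)%N.
rewrite level_ind0.
by case: (2 %| _)%Z.
Qed.

Lemma char_sum_pair_odd (M mu h : nat) be : (mu + h = M)%N ->
  char_sum (wpair t M.*2.+1 mu) be = 2 * (q ^ t * wpair s M.*2.+1 h be)%:R.
Proof.
move=> hM; have hM' : (h + mu = M)%N by rewrite addnC.
have e0 := val_two_ge0 v two_neq0.
have [gen|sp] := pselect (0 < e \/ mu <> h).
  have gen' : 0 < e \/ h <> mu by case: gen => [|n]; [left|right; exact/nesym].
  under eq_char_sum => al do rewrite (wpair_odd al ets hM gen).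
  rewrite char_sumZ char_sum_level (wpair_odd be setss hM' gen').
  rewrite -!natrM; congr (_%:R).
  set i := s%:Z + mu%:Z - h%:Z.
  have -> : t%:Z + h%:Z - mu%:Z = e - i by rewrite ets /i; vlia.
  rewrite !mulnA; congr (_ * level_ind v _ _)%N; rewrite /level_card.
    have [ei|ie] := leP e i.
      have -> : (e + 1 < 0) = false by vlia.
      have -> : (e + 1 <= e) = false by vlia.
      have -> : (e <= e - i) = false by rewrite /i in ei *; vlia.
      by rewrite muln1 expnD mulnA.
    have [i0|i0] := leP i 0.
      have -> : (-1 < 0 :> int) = true by [].
      have -> : (e <= e - i) = true by vlia.
      have -> : `|e|%N = (t + s)%N by vlia.
      by rewrite !expnD; ring.
    have -> : (i < 0) = false by vlia.
    have -> : (i <= e) = true by vlia.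
    have -> : (e <= e - i) = false by vlia.
    have E : (mu + `|(e - i)%R| = t + h)%N by rewrite /i; vlia.
    by rewrite mulnCA -expnD E expnD; ring.
  have [ei|ie] := leP e i.
    have -> : (e <= e - i) = false by rewrite /i in ei *; vlia.
    have -> : (e - i <= 0) = true by vlia.
    by vlia.
  have [i0|i0] := leP i 0.
    have -> : (e <= e - i) = true by vlia.
    by vlia.
  have -> : (e <= e - i) = false by vlia.
  by have -> : (e - i <= 0) = false by vlia.
have ez : e = 0.
  have [//|e1] : e = 0 \/ 0 < e by vlia.
  by case: sp; left.
have mh : mu = h by apply: contrapT => n; apply: sp; right.
have [tz sz] : t = 0%N /\ s = 0%N by move: ets; rewrite ez; vlia.
subst h.
(* The exceptional pair is q^mu times the combination 1, -1, 2 of the indicators of levels -1, 0, 1.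
   These have orders 4, 2, 1 and the transform exchanges the outer two, so the combination is sent
   to twice itself. The negative term is kept on the other side because the values are in [nat]. *)
have key d al : d = 0%N ->
    (wpair d M.*2.+1 mu al + q ^ mu * level_ind v 0 (class_repr al) =
     q ^ mu * level_ind v (-1) (class_repr al) +
     2 * q ^ mu * level_ind v 1 (class_repr al))%N.
  move=> ->; have D0 := class_repr_neq0 al.
  have ez' : e = 0%:Z + 0%:Z by rewrite ez.
  rewrite /wpair (weight_pair_odd localK two_neq0 ez' D0 hM) add0r subrr ez lexx add0r add0n.
  rewrite mul1n (@level_ind_neg _ v (-1))// muln1.
  rewrite level_ind0.
  by case: (2 %| _)%Z => /=; lia.
apply: (@addIr _ (char_sum (fun al => q ^ mu * level_ind v 0 (class_repr al))%N be)).
rewrite -char_sumD; under eq_char_sum => al do rewrite (key t al tz).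
rewrite char_sumD !char_sumZ !char_sum_level ez sub0r opprK subrr sub0r.
have -> : level_card v (-1) = 4%N by rewrite /level_card /= ez muln1.
have -> : level_card v 1 = 1%N by rewrite /level_card /= ez.
have -> : level_card v 0 = 2%N by rewrite /level_card ez.
rewrite -!natrM -!natrD; congr (_%:R).
rewrite tz expn0.
rewrite (_ : q ^ mu * (2 * _) = 2 * (q ^ mu * level_ind v 0 (class_repr be)))%N; last by ring.
by rewrite -[RHS]mulnDr !mul1n (key s be sz); ring.
Qed.

Lemma char_sum_weights n be :
  char_sum (fun al => \sum_(a < n.+1) orbit_weight v (n + t.*2)%:Z a (class_repr al))%N be =
  2 * (q ^ t * \sum_(a < n.+1) orbit_weight v (n + s.*2)%:Z a (class_repr be))%:R.
Proof.
under eq_char_sum => al do rewrite (sum_weights ets n (class_repr_neq0 al)).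
rewrite (sum_weights setss n (class_repr_neq0 be)).
rewrite (char_sum_sum _ (wpair t n)) big_distrr /= natr_sum mulr_sumr.
(* Reversal matches each [mu] with its mirror [n./2 - mu]. *)
rewrite [RHS](reindex_inj rev_ord_inj) /=; apply: eq_bigr => mu _.
have hM : (mu + (n./2 - mu) = n./2)%N by rewrite subnKC// -ltnS.
rewrite subSS; have := char_sum_pair_even be hM; have := char_sum_pair_odd be hM.
by have := odd_double_half n; case: (odd n); rewrite /= ?add0n ?add1n => ->.
Qed.

End Fourier.

Theorem theorem5p2 (R : realType) (K : fieldType) (v : discrete_valuation K)
    (localK : nonarch_local_field v) (charK : 2%N \notin [pchar K])
    (I : K) (intI : integers v I) (I_neq0 : I != 0)
    (tau : K) (int_tau : integers v tau) (tau_dvd2 : dvd_int v tau 2) :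
  fourier (fun al => (orbit_counter v tau I al)%:R : R[i]) =
  (fun be => (ideal_norm v tau)%:R *
     (orbit_counter v (2 * tau^-1) (4 * tau ^- 4 * I) be)%:R).
Proof.
have two_neq0 : (2 : K) != 0 by apply: contra charK => h; rewrite inE /= h.
have f0 := four_neq0 two_neq0.
have [c cint c2] := tau_dvd2.
have tau0 : tau != 0 by apply: contraNneq two_neq0 => h; rewrite c2 h mul0r.
have c0 : c != 0 by apply: contraNneq two_neq0 => h; rewrite c2 h mulr0.
have vt : 0 <= v tau by move: int_tau; rewrite /integers val_geE.
have vc : 0 <= v c by move: cint; rewrite /integers val_geE.
have ve : v 2 = v tau + v c by rewrite {1}c2 dvalM.
pose t := `|v tau|%N; pose s := `|v c|%N.
have ets : v 2 = t%:Z + s%:Z by rewrite /t /s ve; vlia.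
have sE : 2 * tau^-1 = c by rewrite c2; field.
(* In this form v(J') - 2v(c) = v(I) - 2v(tau), so both counters sum over the same range of
   valuations. *)
have J'E : 4 * tau ^- 4 * I = (c / tau) ^+ 2 * I.
  by rewrite -sE; field; rewrite tau0.
have ct0 : c / tau != 0 by rewrite mulf_neq0 ?invr_eq0.
have J'0 : (c / tau) ^+ 2 * I != 0 by rewrite mulf_neq0 ?expf_neq0.
have vJ' : v ((c / tau) ^+ 2 * I) = 2 * s%:Z - 2 * t%:Z + v I.
  rewrite (dvalM v (expf_neq0 2 ct0) I_neq0) (dvalX2 v ct0) dvalM ?invr_eq0// dvalV//.
  by rewrite /t /s; vlia.
have vt2 : 0 <= v tau <= v 2 by vlia.
have vc2 : 0 <= v c <= v 2 by vlia.
apply/funext => be; rewrite sE J'E (ideal_norm_val localK.2 tau0 int_tau) -/t.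
rewrite -natrM.
have -> : fourier (fun al => (orbit_counter v tau I al)%:R : R[i]) be =
  2^-1 * char_sum R[i] (orbit_counter v tau I) be by [].
(* In the negative case the range is empty and both counters vanish. *)
have [neg|pos] := ltP (v I - 2 * t%:Z) 0.
  have hM (J x : K) : v J - 2 * v x < 0 ->
      forall k : int, 0 <= k -> (k <= v J - 2 * v x) = (k < 0%:Z) by move=> *; vlia.
  rewrite (orbit_counter_weights localK two_neq0 be c0 J'0 vc2 (hM _ _ _)); last first.
    by rewrite vJ'; rewrite /s; vlia.
  under eq_char_sum => al.
    rewrite (orbit_counter_weights localK two_neq0 al tau0 I_neq0 vt2 (hM _ _ _)); last first.
      by rewrite /t in neg; vlia.
    rewrite big_ord0.
    over.
  rewrite big_ord0 muln0 (char_sumE localK two_neq0) big1 ?mulr0// => al _.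
  by rewrite mul0r.
pose n := `|(v I - 2 * t%:Z)%R|%N.
have hM (J x : K) : v J - 2 * v x = n%:Z ->
    forall k : int, 0 <= k -> (k <= v J - 2 * v x) = (k < n.+1%:Z) by move=> *; vlia.
rewrite (orbit_counter_weights localK two_neq0 be c0 J'0 vc2 (hM _ _ _)); last first.
  by rewrite vJ'; rewrite /n /s; vlia.
have E1 : v I = (n + t.*2)%N%:Z by rewrite /n /t; vlia.
have E2 : v ((c / tau) ^+ 2 * I) = (n + s.*2)%N%:Z by rewrite vJ' /n /t /s; vlia.
rewrite (@eq_char_sum _ _ _ (fun al =>
    \sum_(a < n.+1) orbit_weight v (n + t.*2)%:Z a (class_repr al))%N); last first.
  move=> al; rewrite -E1; apply: orbit_counter_weights => //; apply: hM.
  by rewrite E1 /t; vlia.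
rewrite (char_sum_weights localK two_neq0 _ ets) E2 mulrA mulVf ?mul1r//.
by rewrite pnatr_eq0.
Qed.
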